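(* Let $F \stackrel{\mathrm{loc}}{\ll} G$ and $M := \mathcal{M}^G F$. (a) If $\Delta G(t_G) = 0$, then $M$ is an $\mathbb{F}^M$-local $\mathbb{F}^\gamma$-martingale on $[0, t_G]$. (b) If $\Delta G(t_G) > 0$ and $M_{t_G}$ is not integrable, then $M$ fails to be a semimartingale on $[0, t_G]$. (c) If $\Delta G(t_G) > 0$ and $M_{t_G}$ is integrable, then $M$ is an $H^1$-$\mathbb{F}^\gamma$-martingale on $[0, t_G]$.
   Context: Analytic setting. Fix a distribution function $G:\mathbb{R}\to[0,1]$ (nondecreasing, right-continuous) with $G(0)=0$ and $\lim_{t\to\infty}G(t)=1$; set $G(\infty):=1$. Put $t_G:=\sup\{t\ge 0: G(t)<1\}\in(0,\infty]$, $\overline{G}:=1-G$, $\Delta G(t_G):=G(t_G)-\lim_{t\uparrow\uparrow t_G}G(t)$ (so $\Delta G(t_G)=0$ if $t_G=\infty$). The notation $t\uparrow\uparrow t_G$ means $t\to t_G$ with $t<t_G$, and $F(v-)$ is the left limit of $F$ at $v$. $\mathrm{d}G$ is the Lebesgue--Stieltjes measure on $(0,\infty)$ induced by $G$. A Borel function $F:[0,\infty)\to\mathbb{R}$ satisfies $F\stackrel{\mathrm{loc}}{\ll}G$ if for every $0<b<t_G$ there is a $\mathrm{d}G$-integrable $f:(0,b]\to\mathbb{R}$ with $F(t)-F(0)=\int_{(0,t]}f(v)\,\mathrm{d}G(v)$ for all $t\in(0,b]$. Then there is a Borel function $\frac{\mathrm{d}F}{\mathrm{d}G}:(0,\infty)\to\mathbb{R}$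 (local density), $\mathrm{d}G$-a.e. unique on $(0,t_G)$, which serves as such an $f$ for every $b\in(0,t_G)$; moreover $F$ is càdlàg on $[0,t_G)$. Define $\mathcal{A}^G F:(0,\infty)\to\mathbb{R}$ by $\mathcal{A}^G F(v)=F(v-)-\frac{\mathrm{d}F}{\mathrm{d}G}(v)\overline{G}(v)$ for $v\in(0,t_G)$; for $v\ge t_G$, $\mathcal{A}^G F(v)=F(t_G-)\mathbf{1}_{\{\Delta G(t_G)>0\}}$ if $F(t_G-):=\lim_{t\uparrow\uparrow t_G}F(t)$ exists in $\mathbb{R}$, and $\mathcal{A}^G F(v)=0$ otherwise. Probabilistic setting. $(\Omega,\mathcal{F},P)$ is a probability space and $\gamma$ a $(0,\infty)$-valued random variable with distribution function $G$. $\mathbb{F}^\gamma=(\mathcal{F}^\gamma_t)_{t\in[0,\infty]}$ is the filtration $\mathcal{F}^\gamma_t=\sigma(\{\gamma\le s\}:s\in(0,t])$. The process $\mathcal{M}^G F=(\mathcal{M}^G_t F)_{t\in[0,\infty]}$ is $\mathcal{M}^G_tF=F(t)\mathbf{1}_{\{t<\gamma\}}+\mathcal{A}^G F(\gamma)\mathbf{1}_{\{t\ge\gamma\}}$. For $M=\mathcal{M}^G F$, $\mathbb{F}^M$ is the raw filtration generated by $M$ (the smallest filtration to which $M$ is adapted); it is a subfiltration of $\mathbb{F}^\gamma$. Filtrations are indexed by $[0,\infty]$ and are not assumed to satisfy the usual conditions. Martingale terminology, for an interval $I=[0,T]$ with $T\in(0,\infty]$ and a filtration $\mathbb{F}$: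 a process $X$ is an $\mathbb{F}$-martingale on $I$ if $P$-a.e. path is càdlàg on $I$, $X$ is $\mathbb{F}$-adapted on $I$, $E[|X_t|]<\infty$ for all $t\in I$, and $E[X_t|\mathcal{F}_s]=X_s$ a.s. for all $s\le t$ in $I$. It is an $H^1$-$\mathbb{F}$-martingale on $I$ if in addition $E[\sup_{t\in I}|X_t|]<\infty$. For a subfiltration $\mathbb{G}$ of $\mathbb{F}$, $X$ is a $\mathbb{G}$-local $\mathbb{F}$-martingale on $I=[0,T]$ if there is an increasing sequence of $\mathbb{G}$-stopping times $(\tau_n)$ with values in $[0,T]$ such that each stopped process $X^{\tau_n}$ is an $\mathbb{F}$-martingale on $I$ and $\lim_{n\to\infty}P[\tau_n=T]=1$; a local $\mathbb{F}$-martingale is an $\mathbb{F}$-local $\mathbb{F}$-martingale. $X$ is an $\mathbb{F}$-semimartingale on $I$ if $X=N+A$ with $N$ a local $\mathbb{F}$-martingale on $I$ and $A$ $\mathbb{F}$-adapted on $I$ with $P$-a.e. path càdlàg and of finite variation on $I$. $X$ is a semimartingale on $I$ if it is an $\mathbb{F}'$-semimartingale on $I$ for some filtration $\mathbb{F}'$ of $\mathcal{F}$. *)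

(* Defs.v *)
From HB Require Import structures.
From mathcomp Require Import all_boot all_order all_algebra.
From mathcomp Require Import all_classical all_reals all_analysis.
Set Implicit Arguments.
Unset Strict Implicit.
Unset Printing Implicit Defensive.
Import Order.TTheory GRing.Theory Num.Theory.
Import numFieldNormedType.Exports.
Local Open Scope classical_set_scope.
Local Open Scope ring_scope.

Section analytic.
Context {R : realType}.
Implicit Types (F f : R -> R) (t : \bar R).

(* The filter "s --> t with s < t" on the real line, for t in ]0, +oo];
   the value at -oo is never used. *)
Definition left_nbhs t : set_system R :=
  match t with
  | r%:E => r^'-
  | +oo%E => +oo_R
  | -oo%E => -oo_R
  end.

Definition left_lim F t : R := lim (F @ left_nbhs t).

Definition tG (G : R -> R) : \bar R :=
  ereal_sup [set t%:E | t in [set t : R | 0 <= t /\ G t < 1]].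

(* G extended by G(oo) := 1 *)
Definition extG (G : R -> R) t : R := if t is r%:E then G r else 1.

Definition jump_tG (G : R -> R) : R := extG G (tG G) - left_lim G (tG G).

Definition density_on (G : cumulative R R) F (b : R) f : Prop :=
  (lebesgue_stieltjes_measure G).-integrable `]0, b] (EFin \o f) /\
  forall t : R, 0 < t <= b ->
    F t - F 0 = \int[lebesgue_stieltjes_measure G]_(v in `]0, t]) f v.

Definition loc_abs_cont (G : cumulative R R) F : Prop :=
  measurable_fun (`[0, +oo[ : set R) F /\
  forall b : R, 0 < b -> (b%:E < tG G)%E -> exists f, density_on G F b f.

(* f is a version of the local density dF/dG. *)
Definition is_local_density (G : cumulative R R) F f : Prop :=
  measurable_fun (`]0, +oo[ : set R) f /\
  forall b : R, 0 < b -> (b%:E < tG G)%E -> density_on G F b f.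

(* A^G F, for the version f of dF/dG; values at v <= 0 are never used. *)
Definition AG (G : R -> R) F f (v : R) : R :=
  if (v%:E < tG G)%E then left_lim F v%:E - f v * (1 - G v)
  else if `[< cvg (F @ left_nbhs (tG G)) >] && (0 < jump_tG G)
       then left_lim F (tG G)
       else 0.

(* Paths are indexed by [0, +oo], a part of \bar R; every point of [0, t[ is
   real, so one-sided limits only involve real times. *)
Definition cadlag_on (T : \bar R) (x : \bar R -> R) : Prop :=
  (forall t : R, 0 <= t -> (t%:E < T)%E -> x s%:E @[s --> t^'+] --> x t%:E) /\
  (forall t, (0 < t <= T)%E -> cvg (x s%:E @[s --> left_nbhs t])).

Definition finite_variation_on (T : \bar R) (x : \bar R -> R) : Prop :=
  exists C : R, forall (n : nat) (t : nat -> \bar R),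
    {homo t : i j / (i <= j)%N >-> (i <= j)%E} ->
    (forall i, (0 <= t i <= T)%E) ->
    \sum_(i < n) `|x (t i.+1) - x (t i)| <= C.

End analytic.

Section probabilistic.
Context {R : realType} {d : measure_display} {Omega : measurableType d}.
Variable P : probability Omega R.
Implicit Types (X Y Z N A : \bar R -> Omega -> R) (FF GG : \bar R -> set_system Omega)
  (T t : \bar R) (tau : Omega -> \bar R).

Definition is_filtration FF : Prop :=
  [/\ forall t, (0 <= t)%E -> sigma_algebra setT (FF t),
      forall t, (0 <= t)%E -> FF t `<=` measurable &
      forall s t, (0 <= s)%E -> (s <= t)%E -> FF s `<=` FF t].

Definition subfiltration GG FF : Prop :=
  forall t, (0 <= t)%E -> GG t `<=` FF t.

Definition measurable_wrt (S : set_system Omega) (Y : Omega -> R) : Prop :=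
  preimage_set_system setT Y measurable `<=` S.

Definition adapted_on T FF X : Prop :=
  forall t, (0 <= t <= T)%E -> measurable_wrt (FF t) (X t).

(* Z is a version of E[Y | S], for Y integrable and S a sub-sigma-algebra. *)
Definition cond_exp_version (S : set_system Omega) (Y Z : Omega -> R) : Prop :=
  [/\ measurable_wrt S Z, P.-integrable setT (EFin \o Z) &
      forall B, S B -> \int[P]_(w in B) (Z w)%:E = \int[P]_(w in B) (Y w)%:E]%E.

Definition martingale_on T FF X : Prop :=
  [/\ {ae P, forall w, cadlag_on T (X ^~ w)},
      adapted_on T FF X,
      forall t, (0 <= t <= T)%E -> P.-integrable setT (EFin \o X t) &
      forall s t, (0 <= s)%E -> (s <= t)%E -> (t <= T)%E ->
        exists2 Z, cond_exp_version (FF s) (X t) Z &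
          {ae P, forall w, Z w = X s w}].

Definition H1_martingale_on T FF X : Prop :=
  martingale_on T FF X /\
  (\int[P]_w ereal_sup [set `|X t w|%:E | t in [set t | 0 <= t <= T]] < +oo)%E.

Definition stopping_time GG tau : Prop :=
  forall t, (0 <= t)%E -> GG t [set w | (tau w <= t)%E].

Definition stopped X tau : \bar R -> Omega -> R :=
  fun t w => X (Order.min t (tau w)) w.

Definition local_martingale_on T GG FF X : Prop :=
  subfiltration GG FF /\
  exists tau : nat -> Omega -> \bar R,
    [/\ forall n, stopping_time GG (tau n),
        forall n w, (0 <= tau n w <= T)%E,
        forall n w, (tau n w <= tau n.+1 w)%E,
        forall n, martingale_on T FF (stopped X (tau n)) &
        P [set w | tau n w = T] @[n --> \oo] --> 1%E].

Definition semimartingale_wrt T FF X : Prop :=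
  exists N A,
    [/\ forall t w, (0 <= t <= T)%E -> X t w = N t w + A t w,
        local_martingale_on T FF FF N,
        adapted_on T FF A &
        {ae P, forall w, cadlag_on T (A ^~ w) /\
                         finite_variation_on T (A ^~ w)}].

Definition semimartingale_on T X : Prop :=
  exists2 FF, is_filtration FF & semimartingale_wrt T FF X.

Definition natural_filtration X : \bar R -> set_system Omega := fun t =>
  <<s \bigcup_(s in [set s | (0 <= s <= t)%E])
        preimage_set_system setT (X s) measurable >>.

(* F^gamma_t = sigma({gamma <= s} : s in ]0, t]) *)
Definition single_jump_filtration (gamma : Omega -> R) :
    \bar R -> set_system Omega := fun t =>
  <<s [set [set w | ((gamma w)%:E <= s)%E] | s in [set s | (0 < s <= t)%E]] >>.

(* M^G F, for the version f of dF/dG. At t = +oo the first branch is void. *)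
Definition MG (gamma : Omega -> R) (G F f : R -> R) : \bar R -> Omega -> R :=
  fun t w => if (t < (gamma w)%:E)%E then F (fine t) else AG G F f (gamma w).

End probabilistic.

(* Main.v *)
Require Import Defs.
From HB Require Import structures.
From mathcomp Require Import all_boot all_order all_algebra.
From mathcomp Require Import all_classical all_reals all_analysis.
From mathcomp Require Import measurable_realfun lra ring.
Set Implicit Arguments.
Unset Strict Implicit.
Unset Printing Implicit Defensive.
Import Order.TTheory GRing.Theory Num.Theory.
Import numFieldNormedType.Exports.
Local Open Scope classical_set_scope.
Local Open Scope ring_scope.

(**
Why the theorem holds. Fubini's theorem for f(u) on the triangle 0 < u < v <= t
is the integration by parts formula of F against 1 - G, and it says that the
mean of M at any t < t_G is F(0) (fubini_triangle, AG_mean). An event known at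
time s in the filtration of the jump either contains the event that gamma > s or
lies in the event that gamma <= s, on which M does not move after s; so for such
a process a constant mean already is the martingale property
(martingale_of_constant_mean), and M stopped at any b < t_G is a martingale.

(a) Without an atom at t_G the jump occurs before t_G almost surely. Stopping
at deterministic times x_n would never let the stopping time reach t_G, and the
jump itself need not be seen by the filtration of M. So M is stopped at x_n only
while it has agreed with F at x_0, ..., x_n, and is left alone otherwise. If F is
not constant near t_G, the x_n can be chosen with F(x_(n+1)) different from
F(x_n), and then M, constant after the jump, must leave the graph of F. If F is
constant near t_G, its density vanishes there and M is a martingale without any
stopping.

(b) Were the variation of F on [0, t_G[ finite, its density would be integrable
(variation_bound) and so would be the terminal value of M. Hence the variation is
infinite, and F is the path of M on [0, t_G[ with positive probability. Consider
the sums of the increments of M along a partition, each multiplied by the sign of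
the increment of F: on that event they are the variation sums of F, and so are
unbounded. If M = N + A, the contribution of A is at most the variation of its
path, and that of the local martingale N is bounded in probability by Burkholder's
weak-type inequality for martingale transforms (transform_weak_type). These two
facts contradict each other (infinite_variation_not_semimartingale).

(c) The constant mean expresses F(t) (1 - G(t)) by an integral of the terminal
value. As 1 - G is at least the mass of the atom, F is bounded on [0, t_G[ and has
a limit at t_G; so the mean is still F(0) at t_G, and the supremum of |M| is at
most a constant plus the modulus of the terminal value.
*)

(** * Burkholder's function *)

Section burkholder_function.
Context {R : realFieldType}.
Implicit Types x y h k : R.

Let sqr_abs x : `|x| ^+ 2 = x ^+ 2.
Proof. by rewrite real_normK ?num_real. Qed.

(** Burkholder's function: the form y^2 - x^2 on the diamond |x| + |y| <= 1, and
    1 - 2 |x| outside. Its mean cannot increase when x runs through a martingale and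
    y through a transform of it with coefficients in [-1, 1] (burkU_step), while it
    dominates the indicator of |y| >= 1 minus 2 |x| (burkU_ge, burkU_ge1). *)
Definition burkU x y : R :=
  if `|x| + `|y| <= 1 then y ^+ 2 - x ^+ 2 else 1 - 2 * `|x|.

(** The slopes in x and in y of an affine function that majorizes burkU in the
    directions (h, k) with |k| <= |h|. *)
Definition burkU_dx x y : R := if `|x| + `|y| <= 1 then - 2 * x else - 2 * Num.sg x.

Definition burkU_dy x y : R := if `|x| + `|y| <= 1 then 2 * y else 0.

Lemma burkU_dx_le2 x y : `|burkU_dx x y| <= 2.
Proof.
rewrite /burkU_dx; case: ifP => xy; rewrite normrM normrN (ger0_norm (ler0n _ _)).
  by have := normr_ge0 x; have := normr_ge0 y; lra.
by rewrite normr_sg; case: (x == 0); rewrite /= ?mulr0 ?mulr1.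
Qed.

Lemma burkU_dy_le2 x y : `|burkU_dy x y| <= 2.
Proof.
rewrite /burkU_dy; case: ifP => xy; rewrite ?normr0// normrM (ger0_norm (ler0n _ _)).
by have := normr_ge0 x; have := normr_ge0 y; lra.
Qed.

Lemma burkU_le x y : burkU x y <= 1 - 2 * `|x|.
Proof.
rewrite /burkU; case: ifP => // xy; rewrite -[x ^+ 2]sqr_abs -[y ^+ 2]sqr_abs.
move: (normr_ge0 x) (normr_ge0 y) xy.
by move: `|x| `|y| => a b a0 b0 ab; nra.
Qed.

Lemma burkU_ge x y : - (2 * `|x|) <= burkU x y.
Proof.
rewrite /burkU; case: ifP => xy; last lra.
rewrite -[x ^+ 2]sqr_abs -[y ^+ 2]sqr_abs.
move: (normr_ge0 x) (normr_ge0 y) xy.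
by move: `|x| `|y| => a b a0 b0 ab; nra.
Qed.

Lemma burkU_ge1 x y : 1 <= `|y| -> 1 - 2 * `|x| <= burkU x y.
Proof.
rewrite /burkU; case: ifP => // xy; rewrite -[x ^+ 2]sqr_abs -[y ^+ 2]sqr_abs.
move: (normr_ge0 x) (normr_ge0 y) xy.
by move: `|x| `|y| => a b a0 b0 ab b1; nra.
Qed.

Lemma burkU_x0_le0 x : burkU x 0 <= 0.
Proof.
rewrite /burkU normr0 addr0; case: ifP => [_|/negbT]; last by rewrite -ltNge; lra.
by rewrite expr0n /= sub0r oppr_le0 sqr_ge0.
Qed.

(** From a point outside the diamond this is the convexity of |x|. From a point
    inside, the right-hand side is the form y^2 - x^2 at the new point plus
    h^2 - k^2; that suffices if the new point is inside, and if it is outside,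
    h^2 - k^2 makes up for the difference between the form and 1 - 2 |x|. *)
Lemma burkU_step x y h k : `|k| <= `|h| ->
  burkU (x + h) (y + k) <= burkU x y + burkU_dx x y * h + burkU_dy x y * k.
Proof.
move=> kh.
have [xy|xy] := leP (`|x| + `|y|) 1; last first.
  rewrite (le_trans (burkU_le _ _))// /burkU /burkU_dx /burkU_dy (lt_geF xy) mul0r addr0.
  suff : Num.sg x * (x + h) <= `|x + h|.
    have -> : Num.sg x * (x + h) = `|x| + Num.sg x * h by rewrite mulrDr -normrEsg.
    lra.
  rewrite (le_trans (ler_norm _))// normrM normr_sg.
  by case: (x == 0); rewrite /= ?mul0r ?mul1r.
rewrite [burkU x y]/burkU /burkU_dx /burkU_dy xy.
have kh2 : k ^+ 2 <= h ^+ 2.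
  by rewrite -[k ^+ 2]sqr_abs -[h ^+ 2]sqr_abs lerXn2r// nnegrE.
rewrite /burkU; case: (leP (`|x + h| + `|y + k|) 1) => [_|xy'].
  by move: kh2; rewrite !sqrrD; lra.
set x' := x + h in xy' *; set y' := y + k in xy' *.
have hE : h = x' - x by rewrite /x' addrC addKr.
have kE : k = y' - y by rewrite /y' addrC addKr.
clearbody x' y'.
suff : (1 - `|x'|) ^+ 2 - y' ^+ 2 <= h ^+ 2 - k ^+ 2.
  by move=> H; have aE := sqr_abs x'; move: H; rewrite hE kE => H; nra.
(* Only far to the left or right of the diamond is the left-hand side positive;
   there the distance travelled to leave the diamond bounds |h| from below. *)
have [y'x'|x'y'] := leP `|1 - `|x'| | `|y'|.
  have : (1 - `|x'|) ^+ 2 <= y' ^+ 2.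
    by rewrite -[X in X <= _]sqr_abs -[X in _ <= X]sqr_abs lerXn2r// nnegrE.
  lra.
have x'1 : 1 <= `|x'|.
  rewrite leNgt; apply/negP => x'1; move: x'y'; rewrite (@gtr0_norm _ (1 - _)); lra.
move: x'y'; rewrite distrC (@ger0_norm _ (_ - 1)) ?subr_ge0// => x'y'.
have h_ge : `|x'| - `|x| <= `|h| by rewrite hE lerB_dist.
have k_le : `|k| <= `|y'| + `|y| by rewrite kE ler_normB.
rewrite -[h ^+ 2]sqr_abs -[k ^+ 2]sqr_abs -[y' ^+ 2]sqr_abs.
move: (normr_ge0 x) (normr_ge0 y) (normr_ge0 y') (normr_ge0 k) xy x'1 x'y' h_ge k_le.
move: `|x| `|y| `|x'| `|y'| `|h| `|k| => a b a' b' u v a0 b0 b'0 v0 ab a'1 b'a' ua vb.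
have u2 : (a' - a) ^+ 2 <= u ^+ 2 by rewrite lerXn2r ?nnegrE; lra.
have v2 : v ^+ 2 <= (b' + 1 - a) ^+ 2 by rewrite lerXn2r ?nnegrE; lra.
move: u2 v2; rewrite !expr2; nra.
Qed.

End burkholder_function.

(** * Integrals against bounded multipliers *)

Section integrable_EFin.
Context {R : realType} {d : measure_display} {T : measurableType d}.
Variables (mu : {measure set T -> \bar R}) (A : set T).
Hypothesis mA : measurable A.
Implicit Types f g : T -> R.

Lemma integrable_EFinD f g : mu.-integrable A (EFin \o f) ->
  mu.-integrable A (EFin \o g) -> mu.-integrable A (EFin \o (fun x => f x + g x)).
Proof. by move=> fi gi; apply: eq_integrable (integrableD mA fi gi). Qed.

Lemma integrable_EFinB f g : mu.-integrable A (EFin \o f) ->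
  mu.-integrable A (EFin \o g) -> mu.-integrable A (EFin \o (fun x => f x - g x)).
Proof. by move=> fi gi; apply: eq_integrable (integrableB mA fi gi). Qed.

Lemma integrable_EFinZ k f : mu.-integrable A (EFin \o f) ->
  mu.-integrable A (EFin \o (fun x => k * f x)).
Proof. by move=> fi; apply: eq_integrable (integrableZl mA k fi). Qed.

End integrable_EFin.

Section bounded_multiplier.
Context {R : realType} {d : measure_display} {T : measurableType d}.
Variable mu : {measure set T -> \bar R}.

Lemma integrable_bounded_mul (D phi : T -> R) (c : R) : mu.-integrable setT (EFin \o D) ->
  measurable_fun setT phi -> (forall w, `|phi w| <= c) ->
  mu.-integrable setT (EFin \o (D \* phi)).
Proof.
move=> iD mphi cphi.
have := @integrableMl _ _ _ mu _ measurableT (EFin \o D) phi iD mphi.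
apply; exists c; split; first exact: num_real.
by move=> M cM w _; exact: le_trans (cphi w) (ltW cM).
Qed.

End bounded_multiplier.

Section sub_sigma_algebra_integrals.
Context {R : realType} {d : measure_display} {T : measurableType d}.
Variable P : probability T R.
Implicit Types (S : set_system T) (D Y phi : T -> R).

Lemma measurable_wrtE S Y (sS : sigma_algebra setT S) :
  measurable_wrt S Y <-> measurable_fun setT (Y : g_sigma_algebraType S -> R).
Proof.
split=> [mY _ B mB|mY _ [B mB <-]].
  by apply: sub_sigma_algebra; apply: mY; exists B.
by have := mY measurableT B mB; rewrite /measurable/= sigma_algebra_id.
Qed.

Lemma measurable_wrt_sub S Y : S `<=` measurable -> measurable_wrt S Y ->
  measurable_fun setT Y.
Proof. by move=> Sm SY _ B mB; apply: Sm; apply: SY; exists B. Qed.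

Lemma measurable_wrt_mono S S' Y : S `<=` S' -> measurable_wrt S Y -> measurable_wrt S' Y.
Proof. by move=> SS' SY; apply: subset_trans SS'. Qed.

(** Applied to a function pointwise: a nonnegative bounded function is within 1 of
    the sum of the indicators of its superlevel sets at the positive integers. *)
Lemma indic_staircase (m : nat) (y : R) : 0 <= y <= m%:R ->
  `|y - \sum_(j < m) (j.+1%:R <= y)%R%:R| <= 1.
Proof.
elim: m y => [|m ih] y /andP[y0 ym].
  by rewrite big_ord0 subr0 (_ : y = 0) ?normr0//; apply/eqP; rewrite eq_le ym y0.
rewrite big_ord_recr/=; have [ym'|my] := leP y m%:R.
  rewrite (_ : (m.+1%:R <= y) = false) ?addr0 ?ih ?y0//.
  by apply/negbTE; rewrite -ltNge (le_lt_trans ym')// ltr_nat.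
have -> : \sum_(i < m) (i.+1%:R <= y)%R%:R = m%:R :> R.
  rewrite -[RHS]mulr1 mulr_natl -[in RHS](card_ord m) -sumr_const.
  by apply: eq_bigr => i _; rewrite (le_trans _ (ltW my))// ler_nat.
have -> : m.+1%:R = m%:R + 1 :> R by rewrite -natr1.
case: (leP (m%:R + 1) y) => /= h; rewrite ler_norml; apply/andP; split; move: ym; rewrite -natr1; lra.
Qed.

(** Up to an error of 1 / (n + 1), phi is an affine combination of indicators of its
    superlevel sets; these belong to S, so D is orthogonal to them. *)
Lemma orthogonal_bounded S D phi (c : R) :
  S `<=` measurable ->
  P.-integrable setT (EFin \o D) ->
  (forall B, S B -> \int[P]_(w in B) D w = 0) -> S setT ->
  measurable_wrt S phi -> (forall w, `|phi w| <= c) ->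
  \int[P]_w (D w * phi w) = 0.
Proof.
move=> Sm iD D0 ST Sphi cphi.
have mphi := measurable_wrt_sub Sm Sphi.
have iDphi := integrable_bounded_mul iD mphi cphi.
have c0 : 0 <= c.
  by have := cphi point; apply: le_trans; exact: normr_ge0.
suff step : forall n : nat, n.+1%:R * `|\int[P]_w (D w * phi w)| <= \int[P]_w `|D w|.
  apply/eqP; rewrite -normr_eq0; apply/eqP/le_anti; rewrite normr_ge0 andbT.
  rewrite leNgt; apply/negP => I0.
  set I := `|_| in step I0.
  have := step (Num.bound (\int[P]_w `|D w| / I)).
  rewrite leNgt => /negP; apply.
  rewrite -ltr_pdivrMr//; apply: (lt_le_trans (archi_boundP _)); last by rewrite ler_nat.
  by rewrite divr_ge0 ?normr_ge0// Rintegral_ge0.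
move=> n; set psi := fun w => n.+1%:R * (phi w + c).
pose m := Num.bound (n.+1%:R * (c + c)).
have psi_bnd w : 0 <= psi w <= m%:R.
  have := cphi w; rewrite ler_norml => /andP[? ?].
  rewrite /psi mulr_ge0 ?ler0n//=; last lra.
  have -> // : n.+1%:R * (phi w + c) <= m%:R.
  apply: le_trans (ltW (archi_boundP _)); first by rewrite ler_wpM2l ?ler0n//; lra.
  by rewrite mulr_ge0 ?ler0n//; lra.
pose B j := [set w | j.+1%:R <= psi w].
have SB j : S (B j).
  apply: Sphi; exists `[j.+1%:R / n.+1%:R - c, +oo[%classic => //.
  rewrite setTI; apply/seteqP; split => w /=; rewrite in_itv/= andbT /B/= /psi.
    by rewrite lerBlDr ler_pdivrMr ?ltr0n// mulrC.
  by rewrite lerBlDr ler_pdivrMr ?ltr0n// mulrC.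
pose s w := \sum_(j < m) \1_(B j) w : R.
have ms : measurable_fun setT s.
  by apply: measurable_sum => j; exact/measurable_indic/Sm/SB.
have s_bnd w : `|psi w - s w| <= 1.
  rewrite (_ : s w = \sum_(j < m) (j.+1%:R <= psi w)%R%:R) ?indic_staircase//.
  by apply: eq_bigr => j _; rewrite indicE mem_setE.
have mpsi : measurable_fun setT psi by apply/measurable_funM => //; exact: measurable_funD.
have iD1 j : P.-integrable setT (EFin \o (D \* \1_(B j))).
  apply: (@integrable_bounded_mul _ _ _ P _ _ 1) => //; first exact/measurable_indic/Sm/SB.
  by move=> w; rewrite indicE; case: (_ \in _); rewrite ?normr1 ?normr0.
have Ds0 : \int[P]_w (D w * s w) = 0.
  rewrite /Rintegral; under eq_integral => w _ do rewrite mulr_sumr -sumEFin.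
  rewrite integral_sum//= => [|j]; last exact: iD1.
  rewrite big1// => j _; have := D0 _ (SB j).
  rewrite Rintegral_mkcond /Rintegral => h.
  transitivity (\int[P]_x (D \_ (B j) x)%:E)%E.
    apply: eq_integral => w _; rewrite indicE patchE.
    by case: (_ \in _); rewrite ?mulr1 ?mulr0.
  rewrite -[LHS]fineK ?h//; apply: integrable_fin_num => //.
  apply: eq_integrable (iD1 j) => // w _; rewrite /= indicE patchE.
  by case: (_ \in _); rewrite ?mulr1 ?mulr0.
have iDps : P.-integrable setT (EFin \o (D \* (psi \- s))).
  by apply: (@integrable_bounded_mul _ _ _ P _ _ 1) => //; exact: measurable_funB.
have is_ : P.-integrable setT (EFin \o (D \* s)).
  apply: (@integrable_bounded_mul _ _ _ P _ _ (1 + m%:R)) => // w.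
  have /andP[? ?] := psi_bnd w; have := s_bnd w.
  by rewrite !ler_norml => /andP[? ?]; apply/andP; split; lra.
have -> : n.+1%:R * `|\int[P]_w (D w * phi w)| = `|\int[P]_w (D w * (psi w - s w))|.
  rewrite -[n.+1%:R]ger0_norm ?ler0n// -normrM; congr (`|_|).
  rewrite -RintegralZl//.
  have -> : \int[P]_w (n.+1%:R * (D w * phi w)) =
     \int[P]_w ((D w * (psi w - s w) + D w * s w) - n.+1%:R * c * D w).
    by apply: eq_Rintegral => w _; rewrite /psi; ring.
  rewrite RintegralB//; last 2 first.
    exact: integrable_EFinD.
    exact: integrable_EFinZ.
  by rewrite RintegralD// Ds0 RintegralZl// D0// mulr0 addr0 subr0.
apply: le_trans (le_normr_Rintegral _ _) _ => //.
apply: le_Rintegral => //.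
- exact: (integrable_norm iDps).
- exact: (integrable_norm iD).
by move=> w _; rewrite normrM ler_piMr.
Qed.

End sub_sigma_algebra_integrals.

(** * The weak-type inequality for martingale transforms *)

Lemma measurable_sgr {R : realType} : measurable_fun [set: R] (@Num.sg R).
Proof.
have -> : @Num.sg R = fun x => if x == 0 then 0 else if x < 0 then -1 else 1.
  by apply/funext => x; case: sgrP.
apply: measurable_fun_ifT => //; first exact: measurable_fun_eqr.
by apply: measurable_fun_ifT => //; exact: measurable_fun_ltr.
Qed.

Section weak_type.
Context {R : realType} {d : measure_display} {T : measurableType d}.
Variable P : probability T R.
Variables (S : nat -> set_system T) (X : nat -> T -> R) (h : nat -> R).
Hypothesis sS : forall i, sigma_algebra setT (S i).
Hypothesis Sm : forall i, S i `<=` measurable.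
Hypothesis Smono : forall i, S i `<=` S i.+1.
Hypothesis SX : forall i, measurable_wrt (S i) (X i).
Hypothesis iX : forall i, P.-integrable setT (EFin \o X i).
Hypothesis XE : forall i B, S i B ->
  \int[P]_(w in B) X i.+1 w = \int[P]_(w in B) X i w.
Hypothesis h1 : forall i, `|h i| <= 1.

Definition transform n w : R := \sum_(i < n) h i * (X i.+1 w - X i w).

Let measurable_transform i : measurable_wrt (S i) (transform i).
Proof.
apply/measurable_wrtE => //; elim: i => [|i ih].
  rewrite (_ : transform 0 = cst 0)//.
  by apply/funext => w; rewrite /transform big_ord0.
have -> : transform i.+1 = transform i \+ (fun w => h i * (X i.+1 w - X i w)).
  by apply/funext => w; rewrite /transform big_ord_recr.
have lift Y : measurable_wrt (S i) Y ->
    measurable_fun setT (Y : g_sigma_algebraType (S i.+1) -> R).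
  by move=> /(measurable_wrt_mono (@Smono i)) /measurable_wrtE; apply.
apply: measurable_funD; first by apply: lift; apply/measurable_wrtE.
apply: measurable_funM => //; apply: measurable_funB; last exact: lift.
by apply/measurable_wrtE.
Qed.

Let measurable_slope i : measurable_wrt (S i)
  (fun w => burkU_dx (X i w) (transform i w) + h i * burkU_dy (X i w) (transform i w)).
Proof.
have mX := (measurable_wrtE (X i) (sS i)).1 (@SX i).
have mg := (measurable_wrtE _ (sS i)).1 (@measurable_transform i).
have mc : measurable_fun [set: g_sigma_algebraType (S i)]
    (fun w => `|X i w| + `|transform i w| <= 1).
  apply: measurable_fun_ler => //.
  by apply: measurable_funD; apply: measurableT_comp.
apply/measurable_wrtE => //; apply: measurable_funD.
  apply: measurable_fun_ifT => //; apply: measurable_funM => //.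
  by apply: measurableT_comp => //; exact: measurable_sgr.
apply: measurable_funM => //; apply: measurable_fun_ifT => //.
exact: measurable_funM.
Qed.

Let mX i : measurable_fun setT (X i).
Proof. exact: measurable_wrt_sub (@Sm i) (@SX i). Qed.

Let mtransform i : measurable_fun setT (transform i).
Proof. exact: measurable_wrt_sub (@Sm i) (@measurable_transform i). Qed.

Let mburkU i : measurable_fun setT (fun w => burkU (X i w) (transform i w)).
Proof.
apply: measurable_fun_ifT; first apply: measurable_fun_ler => //.
- by apply: measurable_funD; apply: measurableT_comp.
- by apply: measurable_funB; apply: measurable_funX.
by apply: measurable_funB => //; apply: measurable_funM => //; apply: measurableT_comp.
Qed.

Let iburkU i : P.-integrable setT (EFin \o (fun w => burkU (X i w) (transform i w))).
Proof.
apply: (@le_integrable _ _ _ _ _ measurableT _ (EFin \o (fun w => 1 + 2 * `|X i w|))).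
- exact/measurable_EFinP.
- move=> w _; rewrite /= lee_fin [leRHS]ger0_norm; last first.
    by rewrite addr_ge0// mulr_ge0.
  have := burkU_le (X i w) (transform i w); have := burkU_ge (X i w) (transform i w).
  have := normr_ge0 (X i w).
  by rewrite ler_norml => ? ? ?; apply/andP; split; lra.
- apply: integrable_EFinD => //; first exact: finite_measure_integrable_cst.
  by apply: integrable_EFinZ => //; exact: (integrable_norm (iX i)).
Qed.

(** By burkU_step an increment of burkU is at most the martingale increment times a
    bounded slope known beforehand, and this product has mean 0. *)
Lemma burkU_supermartingale n : \int[P]_w burkU (X n w) (transform n w) <= 0.
Proof.
elim: n => [|n ih].
  have -> : 0 = \int[P]_w (0 : R) :> R by rewrite Rintegral_cst// mul0r.
  apply: le_Rintegral => //; first exact: finite_measure_integrable_cst.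
  by move=> w _; rewrite /transform big_ord0 burkU_x0_le0.
pose psi w := burkU_dx (X n w) (transform n w) + h n * burkU_dy (X n w) (transform n w).
pose D w := X n.+1 w - X n w.
have psi4 w : `|psi w| <= 4.
  rewrite /psi (le_trans (ler_normD _ _))// normrM.
  have := burkU_dx_le2 (X n w) (transform n w).
  have := burkU_dy_le2 (X n w) (transform n w); have := @h1 n.
  have := normr_ge0 (h n); have := normr_ge0 (burkU_dy (X n w) (transform n w)).
  by move: `|h n| `|burkU_dy _ _| => u v; nra.
have iD : P.-integrable setT (EFin \o D) by exact: integrable_EFinB.
have mpsi := measurable_wrt_sub (@Sm n) (@measurable_slope n).
have D0 B : S n B -> \int[P]_(w in B) D w = 0.
  move=> SB; have mB := Sm SB; rewrite RintegralB//.
  - by rewrite (XE SB) subrr.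
  - by apply: integrableS (iX n.+1).
  - by apply: integrableS (iX n).
have Dpsi : \int[P]_w (D w * psi w) = 0.
  apply: (@orthogonal_bounded _ _ _ P (S n) _ _ 4) => //.
  by have [S0 SC _] := sS n; rewrite -(setD0 setT); exact: SC.
have iDpsi := integrable_bounded_mul iD mpsi psi4.
apply: le_trans ih.
rewrite -[leRHS]addr0 -Dpsi -RintegralD//.
apply: le_Rintegral => //; first exact: integrable_EFinD.
move=> w _; have -> : transform n.+1 w = transform n w + h n * D w.
  by rewrite /transform big_ord_recr.
have -> : X n.+1 w = X n w + D w by rewrite /D addrC subrK.
rewrite (le_trans (burkU_step _ _ _))//.
  by rewrite normrM ler_piMl.
by rewrite -addrA lerD2l/psi; rewrite le_eqVlt; apply/orP; left; apply/eqP; ring.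
Qed.

Lemma transform_weak_type_unit n :
  fine (P [set w | 1 <= `|transform n w|]) <= 2 * \int[P]_w `|X n w|.
Proof.
set B := [set w | _].
have mB : measurable B.
  have mg : measurable_fun setT (fun w => `|transform n w|) by exact: measurableT_comp.
  rewrite (_ : B = setT `&` (fun w => `|transform n w|) @^-1` `[1, +oo[%classic).
    exact: mg.
  by rewrite setTI; apply/seteqP; split => w /=; rewrite in_itv/= andbT.
have iB : P.-integrable setT (EFin \o (\1_B : T -> R)) by exact: integrable_indic.
have -> : fine (P B) = \int[P]_w (\1_B w : R).
  by rewrite /Rintegral integral_indic// setIT.
have iN := integrable_norm (iX n).
rewrite -RintegralZl// -subr_le0 -RintegralB//; last exact: integrable_EFinZ.
apply: le_trans (burkU_supermartingale n).
apply: le_Rintegral => //; first by apply: integrable_EFinB => //; exact: integrable_EFinZ.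
move=> w _; rewrite indicE; case: (boolP (w \in B)) => /= [|_].
  by rewrite inE => /burkU_ge1.
by rewrite sub0r; exact: burkU_ge.
Qed.

End weak_type.

Section weak_type_scaled.
Context {R : realType} {d : measure_display} {T : measurableType d}.
Variable P : probability T R.

(** Burkholder's inequality, reduced to c = 1 by scaling X. The bound does
    not depend on the coefficients h; that makes it a test for semimartingales. *)
Lemma transform_weak_type (S : nat -> set_system T) (X : nat -> T -> R) (h : nat -> R) (c : R) n :
  0 < c ->
  (forall i, sigma_algebra setT (S i)) ->
  (forall i, S i `<=` measurable) ->
  (forall i, S i `<=` S i.+1) ->
  (forall i, measurable_wrt (S i) (X i)) ->
  (forall i, P.-integrable setT (EFin \o X i)) ->
  (forall i B, S i B -> \int[P]_(w in B) X i.+1 w = \int[P]_(w in B) X i w) ->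
  (forall i, `|h i| <= 1) ->
  c * fine (P [set w | c <= `|transform X h n w|]) <= 2 * \int[P]_w `|X n w|.
Proof.
move=> c0 sS Sm Smono SX iX XE h1.
have c'0 : 0 < c^-1 by rewrite invr_gt0.
have := @transform_weak_type_unit _ _ _ P S (fun i w => c^-1 * X i w) h sS Sm Smono _ _ _ h1 n.
have trE w : transform (fun i w => c^-1 * X i w) h n w = c^-1 * transform X h n w.
  by rewrite /transform mulr_sumr; apply: eq_bigr => i _; ring.
have -> : [set w | 1 <= `|transform (fun i w => c^-1 * X i w) h n w|] =
    [set w | c <= `|transform X h n w|].
  apply/funext => w; apply/propext => /=.
  by rewrite trE normrM gtr0_norm// ler_pdivlMl// mulr1.
under eq_Rintegral do rewrite normrM (gtr0_norm c'0).
rewrite RintegralZl//; last exact: (integrable_norm (iX n)).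
rewrite mulrCA ler_pdivlMl//; apply.
- move=> i; apply/measurable_wrtE => //; apply: measurable_funM => //.
  by apply/measurable_wrtE.
- by move=> i; exact: integrable_EFinZ.
- move=> i B SB; have mB := Sm _ _ SB.
  rewrite !RintegralZl// ?(XE _ _ SB)//.
  by apply: integrableS (iX i).
  by apply: integrableS (iX i.+1).
Qed.

End weak_type_scaled.

(** * Variation of an indefinite integral *)

Section integrals_over_sets.
Context {R : realType} {d : measure_display} {T : measurableType d}.
Variable mu : {measure set T -> \bar R}.
Implicit Types (g : T -> R) (A D : set T).

Lemma Rintegral_sub D A g : A `<=` D ->
  \int[mu]_(x in A) g x = \int[mu]_(x in D) (g x * \1_A x).
Proof.
move=> AD; rewrite [LHS]Rintegral_mkcond [RHS]Rintegral_mkcond.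
apply: eq_Rintegral => x _; rewrite !patchE indicE.
case: (boolP (x \in A)) => xA; last by rewrite mulr0 if_same.
by rewrite mulr1; move: xA; rewrite inE => /AD xD; rewrite mem_set.
Qed.

(** Dominated convergence for indicators. It provides the one-sided limits of an
    indefinite integral against a measure with atoms, for which the limiting domain
    of integration depends on the side. *)
Lemma cvg_Rintegral_sets D A (B : nat -> set T) g : measurable D ->
  mu.-integrable D (EFin \o g) -> measurable A -> (forall n, measurable (B n)) ->
  A `<=` D -> (forall n, B n `<=` D) ->
  (forall x, \forall n \near \oo, B n x <-> A x) ->
  \int[mu]_(x in B n) g x @[n --> \oo] --> \int[mu]_(x in A) g x.
Proof.
move=> mD ig mA mB AD BD BA.
have mg : measurable_fun D g by have /integrableP[/measurable_EFinP] := ig.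
have mgB E : measurable E -> measurable_fun D (EFin \o (fun x => g x * \1_E x)).
  by move=> mE; apply/measurable_EFinP/measurable_funM => //; exact: measurable_indic.
have iN := integrable_norm ig.
have pointwise : {ae mu, forall x, D x ->
    (fun n => EFin \o (fun x => g x * \1_(B n) x)) ^~ x @ \oo --> (g x * \1_A x)%:E}.
  apply: aeW => x Dx /=; apply/cvg_EFin; first exact: nearW.
  have [N _ NBA] := BA x.
  apply: cvg_near_cst; exists N => // n /NBA nBA /=.
  by rewrite !indicE; congr (_ * (nat_of_bool _)%:R); apply/idP/idP; rewrite !inE; apply nBA.
have dominated : {ae mu, forall x n, D x ->
    (`|(g x * \1_(B n) x)%R%:E| <= `|g x|%R%:E)%E}.
  apply: aeW => x n Dx /=; rewrite lee_fin normrM indicE.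
  by case: (_ \in _); rewrite ?normr1 ?normr0 ?mulr1 ?mulr0.
have [iA _ cvgB] := dominated_convergence mD (fun n => mgB _ (mB n)) (mgB _ mA)
  pointwise iN dominated.
under eq_fun do rewrite (Rintegral_sub _ (BD _)).
rewrite (Rintegral_sub _ AD); apply: fine_cvg; rewrite fineK//.
exact: integrable_fin_num.
Qed.

End integrals_over_sets.

Section variation.
Context {R : realType}.
Variable mu : {measure set (measurableTypeR R) -> \bar R}.
Implicit Types (E B : set R) (a b c : R).

(** A union of cells of the partition of the line by the points of s. In this form
    stability under complements and unions is immediate, and the points need to be
    sorted only once, in variation_bound. *)
Definition determined_by (s : seq R) E : Prop :=
  forall x y, (forall c, c \in s -> (c < x) = (c < y)) -> E x -> E y.

Section approximation.
Variable g : R -> R.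
Hypothesis g0 : forall x, 0 <= g x.
Hypothesis ig : mu.-integrable setT (EFin \o g).

Let nu B : R := \int[mu]_x (g x * \1_B x).

Let inu B : measurable B -> mu.-integrable setT (EFin \o (fun x => g x * \1_B x)).
Proof.
move=> mB; apply: (le_integrable measurableT _ _ ig).
  apply/measurable_EFinP/measurable_funM; last exact: measurable_indic.
  by have /integrableP[/measurable_EFinP] := ig.
move=> x _; rewrite /= lee_fin normrM indicE.
by case: (_ \in _); rewrite ?normr1 ?normr0 ?mulr1 ?mulr0.
Qed.

Let nuU B B1 B2 : measurable B -> measurable B1 -> measurable B2 ->
  B `<=` B1 `|` B2 -> nu B <= nu B1 + nu B2.
Proof.
move=> mB mB1 mB2 B12; rewrite /nu -RintegralD//; [|exact: inu..].
apply: le_Rintegral => //; [exact: inu|by apply: integrable_EFinD => //; exact: inu|].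
move=> x _; rewrite -mulrDr ler_wpM2l// !indicE.
case: (boolP (x \in B)) => xB; last by rewrite addr_ge0.
have : (x \in B1) || (x \in B2).
  by move: xB; rewrite !inE => /B12[] xB; apply/orP; [left|right]; rewrite inE.
by case: (x \in B1) => /= [_|->]; rewrite ?lerDl// lerDr.
Qed.

Definition approximable B : Prop := measurable B /\ forall e : R, 0 < e ->
  exists s E, [/\ determined_by s E, measurable E & nu (B `+` E) <= e].

Let nu0 : nu set0 = 0.
Proof. by rewrite /nu -(@Rintegral_sub _ _ _ _ setT)// Rintegral_set0. Qed.

Let determinedC s E : determined_by s E -> determined_by s (~` E).
Proof.
move=> sE x y xy nEx Ey; apply: nEx; apply: sE Ey => c cs.
by rewrite (xy _ cs).
Qed.

Let determinedU s1 s2 E1 E2 : determined_by s1 E1 -> determined_by s2 E2 ->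
  determined_by (s1 ++ s2) (E1 `|` E2).
Proof.
move=> sE1 sE2 x y xy [/sE1 E1y|/sE2 E2y]; [left; apply: E1y|right; apply: E2y] => c cs;
by apply: xy; rewrite mem_cat cs ?orbT.
Qed.

Let approximableU B1 B2 : approximable B1 -> approximable B2 -> approximable (B1 `|` B2).
Proof.
move=> [mB1 B1e] [mB2 B2e]; split; first exact: measurableU.
move=> e e0; have e20 : 0 < e / 2 by rewrite divr_gt0.
have [s1 [E1 [sE1 mE1 n1]]] := B1e _ e20.
have [s2 [E2 [sE2 mE2 n2]]] := B2e _ e20.
exists (s1 ++ s2), (E1 `|` E2); split; [exact: determinedU|exact: measurableU|].
rewrite (splitr e); apply: le_trans (lerD n1 n2).
apply: nuU; try by do ?[exact: measurableU|apply: measurableD|apply: measurableU].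
by move=> x [[[|] + /not_orP[? ?]]|[[|] + /not_orP[? ?]]]; rewrite /setY/=; tauto.
Qed.

Let approximable0 : approximable set0.
Proof.
split=> // e e0; exists [::], set0; split => //.
by rewrite setYK nu0 ltW.
Qed.

Let approximable_sigma : sigma_algebra setT approximable.
Proof.
split.
- exact: approximable0.
- move=> B [mB Be]; split; first by rewrite setTD; exact: measurableC.
  move=> e /Be[s [E [sE mE nE]]]; exists s, (~` E); split.
  + exact: determinedC.
  + exact: measurableC.
  + rewrite setTD (_ : ~` B `+` ~` E = B `+` E)//.
    by apply/seteqP; split=> x /=; have [] := pselect (B x); have [] := pselect (E x); tauto.
- move=> B Ba; split; first by apply: bigcup_measurable => n _; case: (Ba n).
  move=> e e0; have e20 : 0 < e / 2 by rewrite divr_gt0.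
  pose U n := \bigcup_(i < n) B i.
  have aU n : approximable (U n).
    elim: n => [|n ih]; first by rewrite /U II0 bigcup_set0; exact: approximable0.
    by rewrite /U IIS bigcup_setU bigcup_set1; exact: approximableU.
  pose D := \bigcup_i B i.
  have mD : measurable D by apply: bigcup_measurable => n _; case: (Ba n).
  have UD n : U n `<=` D by apply: bigcup_subset.
  have : \int[mu]_(x in D `\` U n) g x @[n --> \oo] --> \int[mu]_(x in set0) g x.
    apply: (@cvg_Rintegral_sets _ _ _ _ setT) => //.
      by move=> n; apply: measurableD => //; case: (aU n).
    move=> x; have [[i _ Bix]|nDx] := pselect (D x).
      by exists i.+1 => // n /= ni; split => // -[_]; apply; exists i.
    by apply: nearW => n; split => // -[].
  rewrite Rintegral_set0 => /cvgr0_norm_lt => /(_ _ e20)[n _ /(_ _ (leqnn n))].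
  have mDU : measurable (D `\` U n) by apply: measurableD => //; case: (aU n).
  rewrite /= (@Rintegral_sub _ _ _ _ setT)// -/(nu _) => nDU.
  have [mU Ue] := aU n; have [s [E [sE mE nE]]] := Ue _ e20.
  exists s, E; split => //; rewrite (splitr e).
  apply: le_trans (lerD (ltW (le_lt_trans (ler_norm _) nDU)) nE).
  apply: nuU => //; try by apply: measurableU; apply: measurableD.
  move=> x; rewrite /setY /=; have [] := pselect (U n x); have := @UD n x; tauto.
Qed.

(** The approximable sets form a sigma-algebra, which contains the half-open
    intervals because these are determined by their end points. *)
Lemma approximable_measurable B : measurable B -> approximable B.
Proof.
move: B; apply: (@smallest_sub _ (sigma_algebra setT) R.-ocitv.-measurable approximable).
  exact: approximable_sigma.
move=> _ [[a b] _ <-] /=; split => // e e0.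
exists [:: a; b], `]a, b]%classic; split => //; last by rewrite setYK nu0 ltW.
move=> x y xy /=; rewrite !in_itv/= => /andP[ax xb].
by rewrite -xy ?mem_head// ax leNgt -(xy b) ?inE ?eqxx ?orbT// -leNgt.
Qed.

End approximation.

Let Rintegral_cells (k : R -> R) (x : nat -> R) m :
  {homo x : i j / (i <= j)%N >-> i <= j} -> mu.-integrable `]x 0%N, x m] (EFin \o k) ->
  \int[mu]_(v in `]x 0%N, x m]) k v = \sum_(i < m) \int[mu]_(v in `]x i, x i.+1]) k v.
Proof.
move=> x_mono; elim: m => [|m ih] ik.
  by rewrite big_ord0 set_itv_ge ?Rintegral_set0// bnd_simp -leNgt.
have xxm := @x_mono _ _ (leq0n m); have xmS := @x_mono _ _ (leqnSn m).
have xE : `]x 0%N, x m.+1]%classic = `]x 0%N, x m] `|` `]x m, x m.+1].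
  apply/seteqP; split => v /=; rewrite !in_itv/=.
    by move=> /andP[xv vx]; have [vm|mv] := leP v (x m); [left|right]; rewrite ?xv ?vm.
  by case=> /andP[xv vx]; rewrite ?xv ?vx ?(le_lt_trans xxm xv) ?(le_trans vx xmS).
rewrite big_ord_recr/= -ih; last first.
  by apply: integrableS ik => //; rewrite xE; exact: subsetUl.
rewrite xE Rintegral_setU -?xE//.
rewrite disj_set2E; apply/eqP/seteqP; split => // v [] /=; rewrite !in_itv/=.
by move=> /andP[_ +] /andP[+ _]; rewrite leNgt => /negbTE ->.
Qed.

(** The set where f > 0 is approximated by a union E of cells of a finite partition.
    The integral of f, counted positively on E and negatively off E, is then a signed
    sum of increments of F, and it differs little from the integral of |f|. *)
Lemma variation_bound (f F : R -> R) a b (C : R) : a <= b ->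
  mu.-integrable `]a, b] (EFin \o f) ->
  (forall s t, a <= s -> s <= t -> t <= b ->
     F t - F s = \int[mu]_(v in `]s, t]) f v) ->
  (forall (n : nat) (x : nat -> R), {homo x : i j / (i <= j)%N >-> i <= j} ->
     (forall i, a <= x i <= b) -> \sum_(i < n) `|F (x i.+1) - F (x i)| <= C) ->
  \int[mu]_(v in `]a, b]) `|f v| <= C.
Proof.
move=> ab if_ FE varC.
pose I : set (measurableTypeR R) := `]a, b]%classic; have mI : measurable I by exact: measurable_itv.
pose g x := `|(f \_ I) x|.
have if0 : mu.-integrable setT (EFin \o (f \_ I)).
  by rewrite -restrict_EFin; exact: ((@integrable_mkcond _ _ _ mu I (EFin \o f) mI).1 if_).
have ig : mu.-integrable setT (EFin \o g) by exact: integrable_norm.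
have mf0 : measurable_fun setT (f \_ I) by have /integrableP[/measurable_EFinP] := if0.
pose B := [set x | 0 < (f \_ I) x].
have mB : measurable B.
  have := mf0 measurableT `]0, +oo[%classic (measurable_itv _); rewrite setTI.
  by congr (measurable _); apply/seteqP; split => v; rewrite /= in_itv/= andbT.
have [_ Be] := @approximable_measurable g (fun x => normr_ge0 _) ig B mB.
apply/ler_addgt0Pr => e e0; have e20 : 0 < e / 2 by rewrite divr_gt0.
have [s [E [sE mE nE]]] := Be _ e20.
pose h v : R := if v \in E then 1 else -1.
have mh : measurable_fun setT h.
  rewrite (_ : h = fun v => 2 * \1_E v - 1); last first.
    by apply/funext => v; rewrite /h indicE; case: ifP => _ /=; rewrite ?mulr1 ?mulr0 ?sub0r//; ring.
  by apply: measurable_funB => //; apply: measurable_funM => //; exact: measurable_indic.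
have h1 v : `|h v| <= 1 by rewrite /h; case: ifP => _; rewrite ?normrN normr1.
have ifh (A : set (measurableTypeR R)) : A `<=` I -> measurable A -> mu.-integrable A (EFin \o (fun v => f v * h v)).
  move=> AI mA; apply: (@le_integrable _ _ _ _ _ mA _ (EFin \o f)).
  - apply/measurable_EFinP/measurable_funM; last exact: measurable_funTS.
    by have /integrableP[/measurable_EFinP mf _] := if_; exact: measurable_funS mf.
  - by move=> v _; rewrite /= lee_fin normrM ler_piMr.
  - exact: integrableS if_.
(* The points of s inside ]a, b[ in increasing order, preceded by a. The default
   value b of nth makes the sequence end, and stay, at b. *)
have [x [m [xmono xab x0 xm xs]]] : exists (x : nat -> R) (m : nat),
    [/\ {homo x : i j / (i <= j)%N >-> i <= j}, (forall i, a <= x i <= b), x 0%N = a,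
        x m = b & forall c, c \in s -> a < c < b -> exists j, x j = c].
  pose t := sort <=%R [seq c <- s | a < c < b].
  have ts c : (c \in t) = (a < c < b) && (c \in s) by rewrite mem_sort mem_filter.
  have st : sorted <=%R (a :: t).
    rewrite /= path_min_sorted; first by apply: sort_sorted; exact: le_total.
    by apply/allP => c; rewrite ts => /andP[/andP[/ltW]].
  pose x := nth b (a :: t).
  have xab i : a <= x i <= b.
    have [it|it] := ltnP i (size (a :: t)); last by rewrite /x nth_default// ab lexx.
    rewrite /x; have := mem_nth b it; rewrite inE => /predU1P[->|]; first by rewrite lexx ab.
    by rewrite ts => /andP[/andP[/ltW-> /ltW->]].
  exists x, (size t).+1; split => //.
  - move=> i j ij; have [jt|jt] := ltnP j (size (a :: t)).
      apply: (sorted_leq_nth le_trans le_refl b st) => //.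
      exact: leq_ltn_trans ij jt.
    by rewrite [x j]nth_default//; case/andP: (xab i).
  - by rewrite /x nth_default.
  - move=> c cs acb; exists (index c t).+1; rewrite /x /= nth_index// ts acb cs//.
have fhC : \int[mu]_(v in I) (f v * h v) <= C.
  rewrite /I -x0 -xm Rintegral_cells//; last first.
    by rewrite x0 xm; exact: ifh.
  apply: le_trans (varC m x xmono xab); apply: ler_sum => i _.
  have /andP[axi xib] := xab i; have /andP[axi1 xib1] := xab i.+1.
  have xi1 := xmono _ _ (leqnSn i).
  rewrite FE//.
  set A := `]x i, x i.+1]%classic.
  have AI : A `<=` I.
    move=> v; rewrite /A /I /= !in_itv/= => /andP[xv vx].
    by rewrite (le_lt_trans axi xv) (le_trans vx xib1).
  have [->|/set0P[v0 Av0]] := eqVneq A set0; first by rewrite !Rintegral_set0 normr0.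
  have same u v : A u -> A v -> E u -> E v.
    move=> Au Av; apply: sE => c cs.
    have [acb|] := boolP (a < c < b); last first.
      have := AI _ Au; have := AI _ Av; rewrite /I /= !in_itv/= negb_and -!leNgt.
      move=> /andP[av vb] /andP[au ub] /orP[ca|bc].
        by rewrite (le_lt_trans ca au) (le_lt_trans ca av).
      by rewrite !ltNge (le_trans ub bc) (le_trans vb bc).
    have [j xj] := xs c cs acb; rewrite -xj.
    move: Au Av; rewrite /A /= !in_itv/= => /andP[xu ux] /andP[xv vx].
    have [ij|ji] := ltnP i j.
      have xij := xmono _ _ ij.
      by rewrite !ltNge (le_trans ux xij) (le_trans vx xij).
    have xji := xmono _ _ ji.
    by rewrite (le_lt_trans xji xu) (le_lt_trans xji xv).
  have -> : \int[mu]_(v in A) (f v * h v) = \int[mu]_(v in A) (f v * h v0).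
    apply: eq_Rintegral => v; rewrite inE => Av; congr (_ * _).
    by rewrite /h; congr (if _ then _ else _); apply/idP/idP; rewrite !inE; exact: same.
  have mA : measurable (A : set (measurableTypeR R)) by exact: measurable_itv.
  rewrite RintegralZr//; last exact: (integrableS mI mA AI if_).
  by rewrite (le_trans (ler_norm _))// normrM ler_piMr.
have -> : \int[mu]_(v in I) `|f v| = \int[mu]_v g v.
  rewrite Rintegral_mkcond; apply: eq_Rintegral => v _.
  by rewrite /g !patchE; case: ifP => // _; rewrite normr0.
have ifh0 : mu.-integrable setT (EFin \o (fun v => (f \_ I) v * h v)).
  exact: (integrable_bounded_mul if0 mh h1).
have i1 : mu.-integrable setT (EFin \o (fun v => g v * \1_(B `+` E) v)).
  apply: (@integrable_bounded_mul _ _ _ _ _ _ 1) => //.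
    by apply: measurable_indic; apply: measurableU; apply: measurableD.
  by move=> v; rewrite indicE; case: (_ \in _); rewrite ?normr1 ?normr0.
apply: (@le_trans _ _ (\int[mu]_v ((f \_ I) v * h v + 2 * (g v * \1_(B `+` E) v)))).
  apply: le_Rintegral => //.
    by apply: integrable_EFinD => //; exact: integrable_EFinZ.
  move=> v _; rewrite /g indicE.
  have [vB|vB] := pselect (B v); have [vE|vE] := pselect (E v).
  - rewrite /h (mem_set vE) mulr1 gtr0_norm// lerDl.
    by rewrite !mulr_ge0// ltW.
  - rewrite (@mem_set _ (B `+` E)); last by left.
    by rewrite /h (memNset vE) gtr0_norm// mulr1; lra.
  - rewrite (@mem_set _ (B `+` E)); last by right.
    rewrite /h (mem_set vE) !mulr1; have := ler_norm (- (f \_ I) v); rewrite normrN.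
    lra.
  - rewrite /h (memNset vE) ler0_norm; last by rewrite leNgt; apply/negP.
    rewrite mulrN1 lerDl.
    by rewrite !mulr_ge0// oppr_ge0 leNgt; apply/negP.
rewrite RintegralD//; last exact: integrable_EFinZ.
rewrite RintegralZl//; apply: lerD; last by move: nE; lra.
apply: le_trans fhC; rewrite [leRHS]Rintegral_mkcond le_eqVlt; apply/orP; left; apply/eqP.
apply: eq_Rintegral => v _; rewrite !patchE; case: ifP => // _; exact: mul0r.
Qed.

End variation.

(** * Paths of infinite variation *)

Section semimartingales.
Context {R : realType} {d : measure_display} {T : measurableType d}.
Variable P : probability T R.
Implicit Types (X N A : \bar R -> T -> R) (FF : \bar R -> set_system T) (b : R).

Lemma fine_prob_le (A B : set T) : measurable A -> measurable B -> A `<=` B ->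
  fine (P A) <= fine (P B).
Proof. by move=> mA mB AB; rewrite fine_le ?fin_num_measure// le_measure ?inE. Qed.

Lemma fine_probU (A B : set T) : measurable A -> measurable B ->
  fine (P (A `|` B)) <= fine (P A) + fine (P B).
Proof.
move=> mA mB; rewrite -fineD ?fin_num_measure//.
by rewrite fine_le ?fin_numD ?fin_num_measure ?measureU2//; exact: measurableU.
Qed.

Lemma martingale_Rintegral (t : \bar R) FF X s u B : is_filtration FF ->
  martingale_on P t FF X -> (0 <= s)%E -> (s <= u)%E -> (u <= t)%E -> FF s B ->
  \int[P]_(w in B) X u w = \int[P]_(w in B) X s w.
Proof.
move=> [_ FFm _] [_ _ iX condX] s0 su ut sB.
have mB := FFm _ s0 _ sB.
have iXs : P.-integrable setT (EFin \o X s) by apply: iX; rewrite s0 (le_trans su).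
have [Z [_ iZ ZE] ZX] := condX s u s0 su ut.
rewrite /Rintegral -(ZE _ sB); congr fine; apply: ae_eq_integral => //.
- by apply: measurable_funTS; have /integrableP[] := iZ.
- by apply: measurable_funTS; have /integrableP[] := iXs.
- by apply: filterS ZX => w Zw _; rewrite /= Zw.
Qed.

Section infinite_variation.
Variables (b : R) (b0 : 0 < b) (X : \bar R -> T -> R) (F : R -> R) (E : set T).
Hypotheses (mE : measurable E) (PE0 : (0 < P E)%E).
Hypothesis XF : forall w (t : R), E w -> 0 <= t < b -> X t%:E w = F t.
Hypothesis varF : forall C : R, exists (n : nat) (x : nat -> R),
  [/\ {homo x : i j / (i <= j)%N >-> i <= j}, (forall i, 0 <= x i < b) &
    C < \sum_(i < n) `|F (x i.+1) - F (x i)|].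

(** For a decomposition N + A, the two lemmas below bound in probability the sums of
    increments of A, along a sequence of partitions, and the sign transforms of the
    stopped N, along any partition. *)
Section decomposition.
Variables (FF : \bar R -> set_system T) (fFF : is_filtration FF).
Variables (N A : \bar R -> T -> R).
Hypothesis XNA : forall t w, (0 <= t <= b%:E)%E -> X t w = N t w + A t w.
Hypothesis adA : adapted_on b%:E FF A.
Hypothesis fvA : {ae P, forall w, finite_variation_on b%:E (A ^~ w)}.

Let mA t : (0 <= t <= b%:E)%E -> measurable_fun setT (A t).
Proof.
move=> tb; have /andP[t0 _] := tb; have [_ FFm _] := fFF.
exact: measurable_wrt_sub (FFm _ t0) (adA tb).
Qed.

(** The events that one of the sums exceeds c decrease, as c grows, to an event on
    which the path has infinite variation. *)
Let variation_sums_tight (n : nat -> nat) (x : nat -> nat -> R) (e : R) : 0 < e ->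
  (forall k, {homo x k : i j / (i <= j)%N >-> i <= j}) ->
  (forall k i, 0 <= x k i < b) ->
  exists (c : R) (B : set T), [/\ 0 <= c, measurable B, fine (P B) < e &
    forall k w, ~ B w -> \sum_(i < n k) `|A (x k i.+1)%:E w - A (x k i)%:E w| <= c].
Proof.
move=> e0 xmono xb.
pose Y k w := \sum_(i < n k) `|A (x k i.+1)%:E w - A (x k i)%:E w|.
have xkb k i : (0 <= (x k i)%:E <= b%:E)%E.
  by have /andP[? /ltW ?] := xb k i; rewrite !lee_fin; apply/andP.
have mY k : measurable_fun setT (Y k).
  apply: measurable_sum => i; apply: measurableT_comp => //.
  by apply: measurable_funB; exact: mA.
have mYc k (c : R) : measurable [set w | c < Y k w].
  have := mY k measurableT `]c, +oo[%classic (measurable_itv _); rewrite setTI.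
  by congr (measurable _); apply/seteqP; split => v; rewrite /= in_itv/= andbT.
pose B (c : nat) := \bigcup_k [set w | c%:R < Y k w].
have mB c : measurable (B c) by apply: bigcup_measurable => k _; exact: mYc.
have mIB : measurable (\bigcap_c B c) by apply: bigcap_measurable.
have IB0 : P (\bigcap_c B c) = 0%E.
  apply/negligibleP => //; apply: negligibleS fvA => w Bw [C wC].
  have [k _ /=] := Bw (Num.bound C) I; rewrite ltNge => /negP; apply.
  have C0 : 0 <= C by have := wC 0%N (fun=> 0%E); rewrite big_ord0; apply; rewrite ?lexx ?lee_fin ?ltW.
  apply: (@le_trans _ _ C); last exact/ltW/archi_boundP.
  apply: (wC (n k) (fun i => (x k i)%:E)) => // i j ij.
  by rewrite lee_fin; exact: xmono.
have : P \o B @ \oo --> P (\bigcap_c B c).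
  apply: nonincreasing_cvg_mu => //.
    by rewrite (le_lt_trans (probability_le1 _ _))// ltry.
  apply/nonincreasing_seqP => c; apply/subsetPset => w [k _ /= h]; exists k => //=.
  by apply: le_lt_trans h; rewrite ler_nat.
rewrite IB0 => /fine_cvgP[_] /cvgr0_norm_lt /(_ _ e0)[c _ /(_ _ (leqnn c))] /= Bc.
exists c%:R, (B c); split => // [|k w nB].
  by apply: le_lt_trans Bc; exact: ler_norm.
by rewrite leNgt; apply/negP => ck; apply: nB; exists k.
Qed.

Let sign_transform_tight Y (n : nat) (x : nat -> R) (l : R) : 0 < l ->
  martingale_on P b%:E FF Y ->
  {homo x : i j / (i <= j)%N >-> i <= j} -> (forall i, 0 <= x i < b) ->
  let g w := \sum_(i < n) Num.sg (F (x i.+1) - F (x i)) * (Y (x i.+1)%:E w - Y (x i)%:E w) in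
  measurable [set w | l <= `|g w|] /\
  l * fine (P [set w | l <= `|g w|]) <= 2 * \int[P]_w `|Y b%:E w|.
Proof.
move=> l0 mart xmono xb g; have [sFF FFm FFmono] := fFF.
have [_ adY iY _] := mart.
(* After the partition the chain goes on to time b with coefficient 0: the transform
   is unchanged, and the bound no longer depends on the partition. *)
pose t i := if (i <= n)%N then (x i)%:E else b%:E.
have t0 i : (0 <= t i)%E.
  by rewrite /t; case: ifP => _; rewrite lee_fin; [case/andP: (xb i)|exact: ltW].
have tb i : (t i <= b%:E)%E.
  by rewrite /t; case: ifP => _; rewrite lee_fin//; case/andP: (xb i) => _ /ltW.
have tS i : (t i <= t i.+1)%E.
  rewrite /t; case: ltnP => ni; first by rewrite (ltnW ni) lee_fin; exact: xmono.
  by case: ifP => _; rewrite lee_fin// ltW//; case/andP: (xb i).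
have t0b i : (0 <= t i <= b%:E)%E by rewrite t0 tb.
pose h i := if (i < n)%N then Num.sg (F (x i.+1) - F (x i)) else 0.
have h1 i : `|h i| <= 1.
  by rewrite /h; case: ifP => _; rewrite ?normr0// normr_sg; case: (_ == _).
have := @transform_weak_type _ _ _ P (fun i => FF (t i)) (fun i => Y (t i)) h l n.+1 l0
  (fun i => sFF _ (t0 i)) (fun i => FFm _ (t0 i))
  (fun i => FFmono _ _ (t0 i) (tS i)) (fun i => adY _ (t0b i)) (fun i => iY _ (t0b i))
  (fun i B sB => martingale_Rintegral fFF mart (t0 i) (tS i) (tb i.+1) sB) h1.
have tn : t n.+1 = b%:E by rewrite /t ltnn.
have -> : transform (fun i => Y (t i)) h n.+1 = g.
  apply/funext => w; rewrite /transform big_ord_recr/= {2}/h ltnn mul0r addr0.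
  by apply: eq_bigr => i _; rewrite /h /t ltn_ord (ltnW (ltn_ord i)).
rewrite /= tn; split => //.
have mg : measurable_fun setT (fun w => `|g w|).
  apply: measurableT_comp => //; apply: measurable_sum => i.
  have mYx j : measurable_fun setT (Y (x j)%:E).
    have /andP[x0 /ltW xjb] := xb j.
    have iYx : P.-integrable setT (EFin \o Y (x j)%:E) by apply: iY; rewrite !lee_fin x0.
    by have /integrableP[/measurable_EFinP] := iYx.
  by apply: measurable_funM => //; exact: measurable_funB.
have := mg measurableT `[l, +oo[%classic (measurable_itv _); rewrite setTI.
by congr (measurable _); apply/seteqP; split => v; rewrite /= in_itv/= andbT.
Qed.

(** On E, unless N is stopped before b, the variation sum of F along a partition is
    the sign transform of the stopped martingale plus that of A. If the sum is large,
    one of three events occurs: N is stopped before b, or the sums of A exceed c, or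
    the transform exceeds l. Each has probability below a third of that of E, so they
    cannot cover E. *)
Lemma no_decomposition : ~ local_martingale_on P b%:E FF FF N.
Proof.
move=> [_ [tau [st_tau tau_b _ mart tau_lim]]].
have [sFF FFm FFmono] := fFF.
have p0 : 0 < fine (P E).
  by rewrite fine_gt0// PE0 (le_lt_trans (probability_le1 _ _))// ltry.
have p30 : 0 < fine (P E) / 3 by rewrite divr_gt0.
pose L n := [set w | tau n w = b%:E].
have mL n : measurable (L n).
  have -> : L n = \bigcap_k ~` [set w | (tau n w <= (b - b / k.+1%:R)%R%:E)%E].
    apply/seteqP; split => w /=.
      rewrite /L /= => taub k _ /=; rewrite taub lee_fin; apply/negP.
      by rewrite -ltNge ltrBlDr ltrDl divr_gt0.
    move=> tauw; rewrite /L /=; have /andP[t0 tb] := tau_b n w.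
    apply/eqP; rewrite eq_le tb/= leNgt; apply/negP.
    have h k : ~ (tau n w <= (b - b / k.+1%:R)%R%:E)%E by exact: (tauw k I).
    move: t0 tb h; case: (tau n w) => [r| |]// _ rb h; rewrite lte_fin => rltb.
    have br : 0 < b - r by rewrite subr_gt0.
    apply: (h (Num.bound (b / (b - r)))); rewrite lee_fin lerBrDr.
    rewrite -lerBrDl ler_pdivrMr// mulrC -ler_pdivrMr//.
    apply: le_trans (ltW (archi_boundP _)) _; last by rewrite ler_nat.
    by rewrite divr_ge0// ltW.
  apply: bigcap_measurable => // k _; apply: measurableC.
  have h0 : (0 <= (b - b / k.+1%:R)%R%:E)%E.
    by rewrite lee_fin subr_ge0 ler_pdivrMr// ler_peMr ?ler1n// ltW.
  exact: FFm (st_tau n _ h0).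
have [n Ln] : exists n, fine (P (~` L n)) < fine (P E) / 3.
  move: tau_lim => /fine_cvgP[_] /cvgr_dist_lt /(_ _ p30)[n _ /(_ _ (leqnn n))] /= h.
  exists n; rewrite probability_setC// fineB ?fin_num_measure//.
  exact: le_lt_trans (ler_norm _) h.
pose m : nat -> nat := fun k => projT1 (cid (varF k%:R)).
have /choice[x xP] : forall k, exists x : nat -> R,
  [/\ {homo x : i j / (i <= j)%N >-> i <= j}, (forall i, 0 <= x i < b) &
    k%:R < \sum_(i < m k) `|F (x i.+1) - F (x i)|].
  by move=> k; rewrite /m; case: cid => ? /= [x xP]; exists x.
have xmono k := let: And3 h _ _ := xP k in h.
have xb k := let: And3 _ h _ := xP k in h.
have xvar k := let: And3 _ _ h := xP k in h.
have [c [B [c0 mB PB Bc]]] := @variation_sums_tight m x _ p30 xmono xb.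
pose Y := stopped N (tau n).
pose K := 2 * \int[P]_w `|Y b%:E w|.
have K0 : 0 <= K by rewrite mulr_ge0// Rintegral_ge0.
pose l := (K + 1) / (fine (P E) / 3).
have l0 : 0 < l by rewrite divr_gt0// ltr_wpDl.
pose k := Num.bound (l + c).
have [mG PG] := @sign_transform_tight Y (m k) (x k) l l0 (mart n) (xmono k) (xb k).
set G := [set w | _] in mG PG.
have {}PG : fine (P G) < fine (P E) / 3.
  have : l * fine (P G) < l * (fine (P E) / 3).
    apply: (le_lt_trans PG); rewrite /l divfK ?gt_eqF// -/K; lra.
  by rewrite ltr_pM2l.
have EU : E `<=` ~` L n `|` (B `|` G).
  move=> w Ew; apply: contrapT => /not_orP[/contrapT Lw /not_orP[nB nG]].
  have := xvar k; rewrite ltNge => /negP; apply.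
  apply: (@le_trans _ _ (l + c)); last first.
    by rewrite ltW// archi_boundP// addr_ge0// ltW.
  have XNAx i : X (x k i)%:E w = Y (x k i)%:E w + A (x k i)%:E w.
    have /andP[x0 /ltW xb'] := xb k i.
    by rewrite XNA ?lee_fin ?x0// /Y /stopped Lw min_l// lee_fin.
  have FX i : F (x k i) = Y (x k i)%:E w + A (x k i)%:E w.
    by rewrite -XNAx XF.
  have -> : \sum_(i < m k) `|F (x k i.+1) - F (x k i)| =
    \sum_(i < m k) Num.sg (F (x k i.+1) - F (x k i)) * (Y (x k i.+1)%:E w - Y (x k i)%:E w) +
    \sum_(i < m k) Num.sg (F (x k i.+1) - F (x k i)) * (A (x k i.+1)%:E w - A (x k i)%:E w).
    rewrite -big_split/=; apply: eq_bigr => i _; rewrite -mulrDr.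
    rewrite normrEsg; congr (_ * _); rewrite !FX; ring.
  apply: lerD.
    rewrite (le_trans (ler_norm _))// ltW// ltNge; apply/negP.
    exact: nG.
  apply: le_trans (Bc k w nB); apply: ler_sum => i _.
  rewrite (le_trans (ler_norm _))// normrM normr_sg.
  by case: (_ == _); rewrite ?mul0r ?mul1r.
have mLC := measurableC (mL n).
have := fine_prob_le mE (measurableU _ _ mLC (measurableU _ _ mB mG)) EU.
have := fine_probU mLC (measurableU _ _ mB mG); have := fine_probU mB mG.
lra.
Qed.

End decomposition.

Theorem infinite_variation_not_semimartingale : ~ semimartingale_on P b%:E X.
Proof.
move=> [FF fFF [N [A [XNA locN adA fvA]]]].
apply: (no_decomposition fFF XNA adA) locN.
by apply: filterS fvA => w [].
Qed.

End infinite_variation.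

End semimartingales.

(** * Cadlag paths and modifications of martingales *)

Section left_nbhs_lemmas.
Context {R : realType}.

Lemma near_left_nbhs (a : R) (t : \bar R) : (a%:E < t)%E ->
  \forall s \near left_nbhs t, a < s /\ (s%:E < t)%E.
Proof.
case: t => [t| |]//; rewrite ?lte_fin => at_; rewrite /left_nbhs.
  near=> s; split; near: s; first exact: nbhs_left_gt.
  by apply: filterS (nbhs_left_lt t) => s st; rewrite lte_fin.
near=> s; split; last by rewrite ltry.
by near: s; apply: nbhs_pinfty_gt; exact: num_real.
Unshelve. all: by end_near. Qed.

Global Instance left_nbhs_filter (t : \bar R) : Filter (left_nbhs t).
Proof. by case: t => [t| |]; rewrite /left_nbhs; typeclasses eauto. Qed.

Lemma cadlag_on_eq (T : \bar R) (x y : \bar R -> R) : cadlag_on T x ->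
  (forall t, (0 <= t <= T)%E -> y t = x t) -> cadlag_on T y.
Proof.
move=> [xr xl] yx; split=> [t t0 tT|t /andP[t0 tT]].
  have sT : \forall s \near t^'+, (s%:E <= T)%E.
    case: T tT {xr xl yx} => [T| |]// tT; last by near=> s; rewrite leey.
    near=> s; rewrite lee_fin; apply: ltW; near: s.
    by apply: nbhs_right_lt; rewrite -lte_fin.
  rewrite yx ?lee_fin ?t0 ?(ltW tT)//; apply: cvg_trans (xr t t0 tT).
  apply: near_eq_cvg; near=> s; rewrite yx//; apply/andP; split; last by near: s.
  by rewrite lee_fin (le_trans t0)//; apply: ltW; near: s; exact: nbhs_right_gt.
have /cvg_ex[l xtl] := xl t (introT andP (conj t0 tT)).
apply/cvg_ex; exists l; apply: cvg_trans xtl; apply: near_eq_cvg.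
apply: filterS (near_left_nbhs t0) => s [s0 st].
by rewrite yx// lee_fin (ltW s0) (le_trans (ltW st)).
Unshelve. all: by end_near. Qed.

End left_nbhs_lemmas.

Section martingale_lemmas.
Context {R : realType} {d : measure_display} {T : measurableType d}.
Variable P : probability T R.

Lemma martingale_on_eq (t : \bar R) (FF : \bar R -> set_system T) (X Y : \bar R -> T -> R) :
  is_filtration FF -> adapted_on t FF X -> martingale_on P t FF Y ->
  {ae P, forall w s, (0 <= s <= t)%E -> X s w = Y s w} ->
  martingale_on P t FF X.
Proof.
move=> [_ FFm _] adX [cadY adY iY condY] XY.
have mX s : (0 <= s <= t)%E -> measurable_fun setT (X s).
  by move=> st; have /andP[s0 _] := st; exact: measurable_wrt_sub (FFm _ s0) (adX _ st).
have iX s : (0 <= s <= t)%E -> P.-integrable setT (EFin \o X s).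
  move=> st; have /integrableP[mYs iYs] := iY _ st.
  apply/integrableP; split; first exact/measurable_EFinP/mX.
  rewrite (_ : (\int[P]_x _)%E = \int[P]_x `|(EFin \o Y s) x|)%E//.
  apply: ae_eq_integral => //; first by apply: measurableT_comp => //; exact/measurable_EFinP/mX.
    exact: measurableT_comp.
  by apply: filterS XY => w XYw _ /=; rewrite XYw.
split => //.
- by apply: filterS2 cadY XY => w cadYw XYw; exact: cadlag_on_eq cadYw XYw.
- move=> s u s0 su ut.
  have sT : (0 <= s <= t)%E by rewrite s0 (le_trans su).
  have uT : (0 <= u <= t)%E by rewrite ut (le_trans s0).
  have [Z [mZ iZ ZE] ZY] := condY s u s0 su ut; exists Z; last first.
    by apply: filterS2 ZY XY => w -> XYw; rewrite XYw.
  split => // B sB; rewrite ZE//; have mB := FFm _ s0 _ sB.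
  apply: ae_eq_integral => //.
  + by apply: measurable_funTS; have /integrableP[] := iY _ uT.
  + by apply: measurable_funTS; have /integrableP[] := iX _ uT.
  + by apply: filterS XY => w XYw _; rewrite XYw.
Qed.

(** * The filtration of a single jump *)

Section single_jump.
Variables (gamma : T -> R) (mgamma : measurable_fun setT gamma).
Hypothesis gamma0 : forall w, 0 < gamma w.
Let FF := single_jump_filtration gamma.

Lemma single_jump_sigma t : sigma_algebra setT (FF t).
Proof. exact: smallest_sigma_algebra. Qed.

Let single_jump_le (r : R) t : (r%:E <= t)%E -> FF t [set w | gamma w <= r].
Proof.
move=> rt; have [r0|r0] := ltP 0 r.
  apply: sub_sigma_algebra; exists r%:E; first by rewrite /= lte_fin r0.
  by apply/seteqP; split => w /=; rewrite lee_fin.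
rewrite (_ : [set w | _] = set0); first by have [] := single_jump_sigma t.
by apply/seteqP; split => w //=; rewrite leNgt => /negP; apply; exact: le_lt_trans (gamma0 w).
Qed.

Lemma single_jump_le_time (t : \bar R) : FF t [set w | ((gamma w)%:E <= t)%E].
Proof.
case: t => [t| |].
- have := @single_jump_le t t%:E (lexx _).
  by congr (FF _ _); apply/seteqP; split => w /=; rewrite lee_fin.
- rewrite (_ : [set w | _] = setT `\` set0).
    by have [s0 sC _] := single_jump_sigma +oo%E; exact: sC.
  by rewrite setD0; apply/seteqP; split => w //= _; rewrite leey.
- rewrite (_ : [set w | _] = set0); first by have [] := single_jump_sigma -oo%E.
  by apply/seteqP; split => w.
Qed.

Lemma single_jump_mono s t : (s <= t)%E -> FF s `<=` FF t.
Proof.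
move=> st; apply: smallest_sub; first exact: single_jump_sigma.
move=> _ [u /andP[u0 us] <-]; apply: sub_sigma_algebra; exists u => //=.
by rewrite u0 (le_trans us).
Qed.

Lemma single_jump_filtration_is : is_filtration FF.
Proof.
split=> [t _|t _|s t s0 st]; first exact: single_jump_sigma.
  apply: smallest_sub; first exact: sigma_algebra_measurable.
  move=> _ [[s| |] _ <-].
  - have := mgamma measurableT (measurable_itv `]-oo, s]); rewrite setTI.
    by congr measurable; apply/seteqP; split => w; rewrite /= in_itv/= lee_fin.
  - rewrite (_ : [set w | _] = setT)//.
    by apply/seteqP; split => w //= _; rewrite leey.
  - by rewrite (_ : [set w | _] = set0)//; apply/seteqP; split.
exact: single_jump_mono.
Qed.

(** The alternative holds for the generators, and the sets that satisfy it form a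
    sigma-algebra: before it occurs, nothing is known about the jump but its
    absence. *)
Lemma single_jump_atom t B : FF t B ->
  [set w | (t < (gamma w)%:E)%E] `<=` B \/ B `<=` [set w | ((gamma w)%:E <= t)%E].
Proof.
pose C := [set B : set T | [set w | (t < (gamma w)%:E)%E] `<=` B \/
  B `<=` [set w | ((gamma w)%:E <= t)%E]].
move: B; apply: (@smallest_sub _ (sigma_algebra setT) _ C).
  split; first by right.
    move=> B [tB|Bt]; [right|left] => w /=.
      by move=> [_ nB]; rewrite leNgt; apply/negP => /tB.
    by move=> tw; split => // /Bt /=; rewrite leNgt tw.
  move=> B CB; have [[n tB]|nB] := pselect (exists n, [set w | (t < (gamma w)%:E)%E] `<=` B n).
    by left=> w /tB Bw; exists n.
  right=> w [n _ Bw]; have [tB|] := CB n; last by apply.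
  by exfalso; apply: nB; exists n.
move=> _ [u /andP[u0 ut] <-]; right => w /= /le_trans; exact.
Qed.

(** For a ray B = ]r, +oo[ this is a difference of two events of the filtration, and the
    sets B for which it holds form a sigma-algebra. *)
Lemma single_jump_before t (B : set R) : measurable B ->
  FF t (gamma @^-1` B `&` [set w | ((gamma w)%:E <= t)%E]).
Proof.
have [s0 sC sU] := single_jump_sigma t.
pose C := [set B : set R | FF t (gamma @^-1` B `&` [set w | ((gamma w)%:E <= t)%E])].
have DE (A B' : set T) : FF t A -> FF t B' -> FF t (A `\` B').
  move=> tA tB; have mA : measurable (A : set (g_sigma_algebraType (FF t))).
    exact: sub_sigma_algebra.
  have mB' : measurable (B' : set (g_sigma_algebraType (FF t))) by exact: sub_sigma_algebra.
  have := measurableD mA mB'; rewrite /measurable/= sigma_algebra_id//.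
move: B; suff GC : <<s @RGenOInfty.G R >> `<=` C.
  by move=> B mB; apply: GC; have := RGenOInfty.measurableE R; rewrite /measurable/= => <-.
apply: (@smallest_sub _ (sigma_algebra setT) _ C).
  split; first by rewrite /C/= preimage_set0 set0I.
    move=> B CB; rewrite /C/= setTD preimage_setC.
    rewrite (_ : _ `&` _ = [set w | ((gamma w)%:E <= t)%E] `\`
      (gamma @^-1` B `&` [set w | ((gamma w)%:E <= t)%E])).
      by apply: DE => //; exact: single_jump_le_time.
    by apply/seteqP; split => w /=; tauto.
  move=> B CB; rewrite /C/= preimage_bigcup setI_bigcupl.
  exact: sU.
move=> _ [r ->]; rewrite /C/=.
rewrite (_ : _ `&` _ = [set w | ((gamma w)%:E <= t)%E] `\`
   [set w | ((gamma w)%:E <= mine r%:E t)%E]).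
  apply: DE; first exact: single_jump_le_time.
  apply: (@single_jump_mono (mine r%:E t)); first by rewrite ge_min lexx orbT.
  exact: single_jump_le_time.
apply/seteqP; split => w /=; rewrite in_itv/= andbT le_min lee_fin.
  by move=> [rw ->]; split => //; rewrite andbT leNgt rw.
by move=> [-> /negP]; rewrite andbT -ltNge.
Qed.

Lemma measurable_wrt_single_jump t (c : R) (psi : R -> R) :
  measurable_fun (`]0, +oo[ : set R) psi ->
  measurable_wrt (FF t) (fun w => if (t < (gamma w)%:E)%E then c else psi (gamma w)).
Proof.
move=> mpsi _ [B mB <-]; rewrite setTI.
have [s0 sC sU] := single_jump_sigma t.
have sUU (A1 A2 : set T) : FF t A1 -> FF t A2 -> FF t (A1 `|` A2).
  move=> A1t A2t; rewrite -bigcup2E; apply: sU => -[|[|n]] //=.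
have := @single_jump_before t _ (mpsi (measurable_itv _) _ mB).
have [cB|ncB] := pselect (B c).
  have := sC _ (@single_jump_le_time t); rewrite setTD => /sUU /[apply].
  congr (FF t _); apply/seteqP; split => w /=.
    move=> [/negP|[[_ Bw]]]; first by rewrite -ltNge => ->.
    by move=> h; rewrite ltNge h.
  have [tw _|wt Bw] := ltP t (gamma w)%:E.
    by left.
  by right; rewrite /= in_itv/= gamma0.
congr (FF t _); apply/seteqP; split => w /=.
  by move=> [[_ Bw] h]; rewrite ltNge h.
by have [//|wt Bw] := ltP t (gamma w)%:E; rewrite in_itv/= gamma0.
Qed.

(** An event of time s, or its complement, lies in the event that gamma <= s, where X
    no longer moves after s; the equality of the means takes care of the rest. *)
Lemma martingale_of_constant_mean (t : \bar R) (X : \bar R -> T -> R) (m : R) :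
  {ae P, forall w, cadlag_on t (X ^~ w)} ->
  adapted_on t FF X ->
  (forall s, (0 <= s <= t)%E -> P.-integrable setT (EFin \o X s)) ->
  (forall s u w, (0 <= s)%E -> (s <= u)%E -> (u <= t)%E -> ((gamma w)%:E <= s)%E ->
     X u w = X s w) ->
  (forall s, (0 <= s <= t)%E -> \int[P]_w X s w = m) ->
  martingale_on P t FF X.
Proof.
move=> cadX adX iX stopX meanX; split => // s u s0 su ut.
have sT : (0 <= s <= t)%E by rewrite s0 (le_trans su).
have uT : (0 <= u <= t)%E by rewrite ut (le_trans s0).
exists (X s); last exact: aeW.
have iXs := iX _ sT; have iXu := iX _ uT; have [_ FFm _] := single_jump_filtration_is.
split => //; first exact: adX.
have small B : measurable B -> B `<=` [set w | ((gamma w)%:E <= s)%E] ->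
    (\int[P]_(w in B) (X s w)%:E = \int[P]_(w in B) (X u w)%:E)%E.
  move=> mB Bs; apply: eq_integral => w; rewrite inE => /Bs ws.
  by rewrite (stopX s u).
move=> B sB; have mB := FFm _ s0 _ sB; have mBC := measurableC mB.
have [sB'|Bs] := single_jump_atom sB; last exact: small.
have split_int Y : P.-integrable setT (EFin \o Y) ->
    (\int[P]_(w in B) (Y w)%:E = (\int[P]_w Y w)%:E - \int[P]_(w in ~` B) (Y w)%:E)%E.
  move=> iY.
  have iB : P.-integrable B (EFin \o Y) by exact: integrableS iY.
  have iBC : P.-integrable (~` B) (EFin \o Y) by exact: integrableS iY.
  rewrite /Rintegral fineK; last exact: (integrable_fin_num measurableT iY).
  rewrite -(setvU B) integral_setU//; last 2 first.
    by apply: measurable_funTS; have /integrableP[] := iY.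
    by rewrite disj_set2E setICl.
  by rewrite addeAC subee ?add0e//; exact: integrable_fin_num.
rewrite !split_int// !meanX// small//.
by move=> w /= nB; rewrite leNgt; apply/negP => /sB'.
Qed.

End single_jump.
End martingale_lemmas.

(** * The law of the jump time *)

Section law.
Context {R : realType} {d : measure_display} {Omega : measurableType d}.
Variables (P : probability Omega R) (G : cumulativeBounded (0 : R) (1 : R)).
Hypothesis hG0 : G 0 = 0.
Variables (gamma : {RV P >-> R}).
Hypothesis hgamma : forall t : R, cdf gamma t = (G t)%:E.
Let mu := lebesgue_stieltjes_measure G.

(** Stieltjes measures live on measurableTypeR R, whose measurable structure is not
    syntactically that of R. *)
Let gam : Omega -> measurableTypeR R := gamma.

Let mgam : measurable_fun setT gam.
Proof. exact: (@measurable_funP _ _ _ _ setT gamma). Qed.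

#[local] HB.instance Definition _ := @isMeasurableFun.Build _ _ _ _ gam mgam.

Lemma G_nd : {homo G : x y / x <= y}.
Proof. exact: cumulative_is_nondecreasing. Qed.

Lemma G_ge0 t : 0 <= G t.
Proof. by rewrite -lee_fin -hgamma. Qed.

Lemma G_le1 t : G t <= 1.
Proof. by rewrite -lee_fin -hgamma; exact: probability_le1. Qed.

Lemma stieltjes_itv a b : a <= b -> mu `]a, b] = (G b - G a)%:E.
Proof.
move=> ab; rewrite /mu /lebesgue_stieltjes_measure /measure_extension/=.
by rewrite measurable_mu_extE/= ?wlength_itv_bnd//; exact: is_ocitv.
Qed.

(** Both measures agree on half-open intervals. *)
Lemma stieltjes_law (A : set R) : measurable A -> mu A = P (gamma @^-1` A).
Proof.
move=> mA.
pose nu : {measure set (measurableTypeR R) -> \bar R} := distribution P gam.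
suff muE : forall X, ocitv X -> lebesgue_stieltjes_measure G X = nu X.
  exact: (@lebesgue_stieltjes_measure_unique R G nu muE A mA).
move=> _ [[a b] _ <-]/=.
have [ab|ba] := leP a b; last by rewrite set_itv_ge ?measure0// bnd_simp -leNgt ltW.
rewrite -/mu stieltjes_itv// EFinB -!hgamma /cdf -/nu.
have -> : `]a, b]%classic = `]-oo, b] `\` `]-oo, a] :> set R.
  by rewrite -[RHS]setCK setCD setCitvl setUC -[LHS]setCK setCitv.
rewrite measureD ?setIidr//; first exact: subset_itvl.
by rewrite -ge0_fin_numE// fin_num_measure.
Qed.

Lemma law_integrable (A : set R) (h : R -> R) : measurable A -> measurable_fun A h ->
  mu.-integrable A (EFin \o h) <-> P.-integrable (gamma @^-1` A) (EFin \o (h \o gamma)).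
Proof.
move=> mA mh.
have mgA : measurable (gamma @^-1` A) by rewrite -[X in measurable X]setTI; exact: measurable_funP.
have mhg : measurable_fun (gamma @^-1` A) (h \o gamma).
  apply: (measurable_comp mA) => //; first by move=> _ [w Aw <-].
  exact: measurable_funTS.
have E : (\int[mu]_(x in A) `|(h x)%:E| = \int[P]_(w in gamma @^-1` A) `|(h (gamma w))%:E|)%E.
  rewrite -(@ge0_integral_pushforward _ _ _ _ _ gam mgam P A (fun x => `|(h x)%:E|%E))//.
    by apply: eq_measure_integral => B mB _; exact: stieltjes_law.
  by apply: measurableT_comp => //; exact/measurable_EFinP.
split=> /integrableP[_ hoo]; apply/integrableP; split; try exact/measurable_EFinP.
  by rewrite /= -E.
by rewrite /= E.
Qed.

Lemma law_Rintegral (A : set R) (h : R -> R) : measurable A -> mu.-integrable A (EFin \o h) ->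
  \int[mu]_(x in A) h x = \int[P]_(w in gamma @^-1` A) h (gamma w).
Proof.
move=> mA ih; have mh : measurable_fun A h by have /integrableP[/measurable_EFinP] := ih.
have mgA : measurable (gamma @^-1` A) by rewrite -[X in measurable X]setTI; exact: measurable_funP.
rewrite /Rintegral; congr fine.
transitivity (\int[mu]_(x in A) ((h \_ A) x)%:E)%E.
  by apply: eq_integral => x xA; rewrite patchE xA.
rewrite (eq_measure_integral (pushforward P gam)); last first.
  by move=> B mB _; exact: stieltjes_law.
rewrite (integral_pushforward mgam)//.
- by apply: eq_integral => w; rewrite inE => Aw; rewrite /= patchE mem_set.
- by apply/measurable_EFinP; exact/(measurable_restrictT _ mA).
- apply: eq_integrable ((law_integrable mA mh).1 ih) => // w; rewrite inE => Aw.
  by rewrite /= patchE mem_set.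
Qed.

Lemma tG_gt0 : (0 < tG G)%E.
Proof.
have : G x @[x --> 0^'+] --> G 0 by exact: cumulative_is_right_continuous.
rewrite hG0 => /cvgrPdist_lt /(_ 1 ltr01) G1.
have [t [t0 Gt]] : exists t, 0 < t /\ G t < 1.
  near (0 : R)^'+ => t; exists t; split; first by near: t; exact: nbhs_right_gt.
  have : `|0 - G t| < 1 by near: t.
  by rewrite sub0r normrN ger0_norm ?G_ge0.
apply: (@lt_le_trans _ _ t%:E); first by rewrite lte_fin.
by apply: ereal_sup_ubound; exists t => //; split => //; exact: ltW.
Unshelve. all: by end_near. Qed.

Lemma G_eq1 (t : R) : (tG G <= t%:E)%E -> G t = 1.
Proof.
move=> tGt.
have G1 s : t < s -> G s = 1.
  move=> ts; apply/eqP; rewrite eq_le G_le1 leNgt; apply/negP => Gs.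
  have t0 : 0 < t by rewrite -lte_fin (lt_le_trans tG_gt0).
  have : (s%:E <= tG G)%E.
    by apply: ereal_sup_ubound; exists s => //; split=> //; rewrite ltW// (lt_trans t0).
  by move=> /le_trans /(_ tGt); rewrite lee_fin leNgt ts.
have Gt : G x @[x --> t^'+] --> G t by exact: cumulative_is_right_continuous.
have Gone : G x @[x --> t^'+] --> (1 : R).
  by apply: cvg_near_cst; near=> s; apply: G1; near: s; exact: nbhs_right_gt.
exact: cvg_unique Gt Gone.
Unshelve. all: by end_near. Qed.

Lemma prob_gamma_le (t : R) : P [set w | gamma w <= t] = (G t)%:E.
Proof.
rewrite -hgamma /cdf /distribution /pushforward; congr (P _).
Qed.

Lemma gamma_le_tG : {ae P, forall w, ((gamma w)%:E <= tG G)%E}.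
Proof.
have := tG_gt0; have := @G_eq1; case: (tG G) => [t| |]// G1 _; last first.
  by apply: aeW => w; rewrite leey.
have mt : measurable [set w | gamma w <= t].
  have := @measurable_funP _ _ _ _ setT gamma measurableT _ (measurable_itv `]-oo, t]).
  by rewrite setTI; congr measurable; apply/seteqP; split => w; rewrite /= in_itv.
exists (~` [set w | gamma w <= t]); split; first exact: measurableC.
  by rewrite probability_setC// prob_gamma_le G1// subee.
by move=> w /=; rewrite lee_fin.
Qed.

End law.

(** * Integration by parts *)

Section fubini_triangle.
Context {R : realType}.
Variable G : cumulativeBounded (0 : R) (1 : R).
Let mu : probability (measurableTypeR R) R := lebesgue_stieltjes_measure G.
Let T := measurableTypeR R.

(** Both sides are the integral of f(u) over the triangle 0 < u < v <= t. *)
Lemma fubini_triangle (f : R -> R) (t : R) : mu.-integrable `]0, t] (EFin \o f) ->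
  \int[mu]_(v in `]0, t]) (\int[mu]_(u in `]0, v[) f u) =
  \int[mu]_(u in `]0, t]) (f u * (G t - G u)).
Proof.
move=> if_; pose J : set T := `]0, t]%classic.
have mJ : measurable J by exact: measurable_itv.
pose D : set (T * T) := [set z | (z.1 < z.2) && (z.2 <= t)].
have midT : measurable_fun setT (id : T -> R) by exact: (@measurable_id _ T setT).
have mD : measurable D.
  have m1 : measurable_fun setT (fun z : T * T => z.1 : R).
    by apply: measurableT_comp midT _; exact: measurable_fst.
  have m2 : measurable_fun setT (fun z : T * T => z.2 : R).
    by apply: measurableT_comp midT _; exact: measurable_snd.
  have mb : measurable_fun setT (fun z : T * T => ((z.1 : R) < z.2) && ((z.2 : R) <= t)).
    by apply: measurable_and; [exact: measurable_fun_ltr|exact: measurable_fun_ler].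
  have := mb measurableT [set true] I; rewrite setTI.
  by congr measurable; apply/seteqP; split => z.
pose f0 := f \_ J.
have if0 : mu.-integrable setT (EFin \o f0).
  by rewrite -restrict_EFin; exact: ((@integrable_mkcond _ _ _ mu J (EFin \o f) mJ).1 if_).
have mf0 : measurable_fun setT f0 by have /integrableP[/measurable_EFinP] := if0.
pose k (z : T * T) := (f0 z.1 * \1_D z)%:E.
have mk : measurable_fun setT k.
  apply/measurable_EFinP/measurable_funM; last exact: measurable_indic.
  by apply: measurableT_comp => //.
have mut (u : T) : measurable (`]u, t]%classic : set T) by exact: measurable_itv.
have kE u v : \1_D (u, v) = \1_(`]u, t]%classic : set T) v :> R.
  by rewrite !indicE; congr (_%:R); congr nat_of_bool; apply/idP/idP; rewrite !inE /D/= in_itv.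
have inner1 (c : R) u : (\int[mu]_v (c * \1_(`]u, t]%classic : set T) v)%:E =
    (c * fine (mu (`]u, t]%classic : set T)))%:E)%E.
  under eq_integral do rewrite EFinM.
  rewrite integralZl//; last exact: integrable_indic.
  by rewrite integral_indic// setIT EFinM fineK// fin_num_measure.
have ik : (mu \x mu)%E.-integrable setT k.
  apply/integrable12ltyP => //.
  have /integrableP[_] := if0; apply: le_lt_trans.
  apply: ge0_le_integral => //.
  - by move=> u _; exact: integral_ge0.
  - apply: (measurable_fun_fubini_tonelli_F (abse \o k)) => //=.
    exact: measurableT_comp.
  - by apply: measurableT_comp => //; exact/measurable_EFinP.
  move=> u _; apply: (@le_trans _ _ (\int[mu]_(v in setT) `|(f0 u)%:E|)%E).
    apply: ge0_le_integral => //.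
      by apply: measurableT_comp => //; exact: measurableT_comp mk _.
    move=> v _; rewrite /k/= lee_fin normrM indicE.
    by case: (_ \in _); rewrite ?normr1 ?normr0 ?mulr1 ?mulr0.
  rewrite integral_cst// [X in (_ * X <= _)%E](_ : _ = 1%E) ?mule1//.
  exact: (probability_setT mu).
have := Fubini ik.
have -> : (\int[mu]_u \int[mu]_v k (u, v) =
    \int[mu]_(u in J) (f u * (G t - G u))%:E)%E.
  rewrite [RHS]integral_mkcond; apply: eq_integral => u _.
  rewrite /k/=; under eq_integral do rewrite kE.
  rewrite inner1 /f0 !patchE; case: ifP => [|_]; last by rewrite mul0r.
  rewrite inE /J/= in_itv/= => /andP[_ ut]; congr (_ * _)%:E.
  by rewrite /mu stieltjes_itv.
have -> : (\int[mu]_v \int[mu]_u k (u, v) =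
    \int[mu]_(v in J) (\int[mu]_(u in `]0%R, v[) f u)%R%:E)%E.
  rewrite [RHS]integral_mkcond; apply: eq_integral => v _.
  rewrite patchE; case: ifP => [|].
    rewrite inE /J/= in_itv/= => /andP[v0 vt].
    have iv : mu.-integrable `]0, v[ (EFin \o f).
      apply: (integrableS _ _ _ if_); [exact: measurable_itv..|].
      by move=> u /=; rewrite !in_itv/= => /andP[-> /ltW uv]; exact: le_trans uv vt.
    rewrite /Rintegral fineK; last first.
      by apply: integrable_fin_num iv; exact: measurable_itv.
    rewrite [RHS]integral_mkcond; apply: eq_integral => u _.
    rewrite /k/= kE indicE /f0 !patchE.
    have -> : (v \in `]u, t]%classic) = (u < v).
      by apply/idP/idP; rewrite inE /= in_itv/= vt andbT.
    have [uv|vu] := ltP u v; last first.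
      rewrite mulr0 ifF//; apply/negbTE; rewrite notin_setE /= in_itv/= => /andP[_].
      by rewrite ltNge vu.
    rewrite mulr1 (_ : (u \in J) = (u \in `]0, v[%classic)).
      by case: ifP.
    by apply/idP/idP; rewrite !inE /J/= !in_itv/= uv (ltW (lt_le_trans uv vt)).
  move=> vJ; rewrite (eq_integral (cst 0%E)) ?integral0// => u _.
  rewrite /k/= kE indicE /f0 patchE; case: ifP => [uJ|_]; last by rewrite mul0r.
  case: (boolP (v \in _)) => [uv|_]; last by rewrite mulr0.
  exfalso; move/negP : vJ; apply; move: uJ uv; rewrite !inE /J/= !in_itv/=.
  by move=> /andP[u0 _] /andP[uv ->]; rewrite (lt_trans u0 uv).
by rewrite /Rintegral => ->.
Qed.

End fubini_triangle.

Section local_density.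
Context {R : realType}.
Variable G : cumulativeBounded (0 : R) (1 : R).
Hypothesis G0 : G 0 = 0.
Hypothesis Gle1 : forall t, G t <= 1.
Variables (F f : R -> R).
Hypothesis mF : measurable_fun (`[0, +oo[ : set R) F.
Hypothesis densf : is_local_density G F f.
Let mu : probability (measurableTypeR R) R := lebesgue_stieltjes_measure G.
Let T := measurableTypeR R.

Let mitv (i : interval R) : measurable ([set` i] : set T).
Proof. exact: measurable_itv. Qed.

Let Gge0 (v : R) : 0 <= v -> 0 <= G v.
Proof. by move=> v0; have := G_nd G v0; rewrite G0. Qed.

Lemma below_tG (t : R) : (t%:E < tG G)%E -> exists b, t < b /\ (b%:E < tG G)%E.
Proof.
move=> /ereal_sup_gt[_ [s [s0 Gs] <-]]; rewrite lte_fin => ts.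
exists ((t + s) / 2); split; first by rewrite midf_lt.
apply: (@lt_le_trans _ _ s%:E); first by rewrite lte_fin midf_lt.
by apply: ereal_sup_ubound; exists s.
Qed.

Lemma density_integrable (b : R) : (b%:E < tG G)%E -> mu.-integrable `]0, b] (EFin \o f).
Proof.
move=> bt; have [b0|b0] := ltP 0 b; first by have [_ /(_ b b0 bt)[]] := densf.
rewrite set_itv_ge; first exact: integrable_set0.
by rewrite bnd_simp -leNgt.
Qed.

Lemma density_F0 (t : R) : 0 <= t -> (t%:E < tG G)%E ->
  F t = F 0 + \int[mu]_(v in `]0, t]) f v.
Proof.
rewrite le_eqVlt => /predU1P[<- _|t0 tt].
  by rewrite set_itv_ge ?Rintegral_set0 ?addr0// bnd_simp ltxx.
have [_ /(_ t t0 tt)[_ /(_ t)]] := densf.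
by rewrite t0 lexx => /(_ isT) <-; rewrite addrC subrK.
Qed.

Lemma density_FB (s t : R) : 0 <= s -> s <= t -> (t%:E < tG G)%E ->
  F t - F s = \int[mu]_(v in `]s, t]) f v.
Proof.
move=> s0 st tt.
have ss : (s%:E < tG G)%E by apply: le_lt_trans tt; rewrite lee_fin.
rewrite (density_F0 (le_trans s0 st) tt) (density_F0 s0 ss).
have tE : `]0, t]%classic = `]0, s] `|` `]s, t] :> set T.
  apply/seteqP; split => v /=; rewrite !in_itv/=.
    by move=> /andP[v0 vt]; have [vs|sv] := leP v s; [left; rewrite v0|right].
  move=> [/andP[-> /le_trans]|/andP[sv ->]]; first exact.
  by rewrite (le_lt_trans s0 sv).
rewrite tE Rintegral_setU.
- by rewrite opprD addrACA subrr add0r addrAC subrr add0r.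
- exact: measurable_itv.
- exact: measurable_itv.
- by rewrite -tE; exact: density_integrable.
- rewrite disj_set2E; apply/eqP/seteqP; split => // v [] /=; rewrite !in_itv/=.
  by move=> /andP[_ +] /andP[+ _]; rewrite leNgt => /negbTE ->.
Qed.

Lemma density_cvg_right (t : R) : 0 <= t -> (t%:E < tG G)%E -> F x @[x --> t^'+] --> F t.
Proof.
move=> t0 tt; have [b [tb bt]] := below_tG tt.
apply/cvg_at_rightP => u [ut u_t].
have : \int[mu]_(v in `]0, Num.min (u n) b]) f v @[n --> \oo] --> \int[mu]_(v in `]0, t]) f v.
  apply: (@cvg_Rintegral_sets _ _ _ mu (`]0, b]%classic : set T) _ _ _ (mitv _)
     (density_integrable bt) (mitv _) (fun n => mitv _)).
  - by move=> v /=; rewrite !in_itv/= => /andP[-> /le_trans]; apply; exact: ltW.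
  - by move=> n v /=; rewrite !in_itv/= le_min => /and3P[-> _ ->].
  move=> x; have [xt|tx] := leP x t.
    apply: nearW => n /=; rewrite !in_itv/= le_min (le_trans xt (ltW (ut n))).
    by rewrite (le_trans xt (ltW tb)) xt.
  have : \forall n \near \oo, u n < x by apply: cvgr_lt u_t _ tx.
  apply: filterS => n unx /=; rewrite !in_itv/= le_min [x <= t]leNgt tx andbF.
  by rewrite leNgt unx/= andbF.
move=> /(cvgD (cvg_cst (F 0))); rewrite -density_F0//.
apply: cvg_trans; apply: near_eq_cvg.
have : \forall n \near \oo, u n < b by apply: cvgr_lt u_t _ tb.
apply: filterS => n unb.
change (F 0 + \int[mu]_(v in `]0, Num.min (u n) b]) f v = F (u n)).
rewrite min_l ?(ltW unb)//.
rewrite -density_F0//; first by rewrite (le_trans t0)// ltW.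
by apply: lt_trans bt; rewrite lte_fin.
Qed.

Lemma density_cvg_left (t : R) : 0 < t -> (t%:E < tG G)%E ->
  F x @[x --> t^'-] --> F 0 + \int[mu]_(v in `]0, t[) f v.
Proof.
move=> t0 tt.
apply/cvg_at_leftP => u [ut u_t].
have : \int[mu]_(v in `]0, u n]) f v @[n --> \oo] --> \int[mu]_(v in `]0, t[) f v.
  apply: (@cvg_Rintegral_sets _ _ _ mu (`]0, t]%classic : set T) _ _ _ (mitv _)
     (density_integrable tt) (mitv _) (fun n => mitv _)).
  - by move=> v /=; rewrite !in_itv/= => /andP[-> /ltW].
  - by move=> n v /=; rewrite !in_itv/= => /andP[-> /le_trans]; apply; exact: ltW.
  move=> x; have [tx|xt] := leP t x.
    apply: nearW => n /=; rewrite !in_itv/= [x < t]ltNge tx andbF.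
    by rewrite leNgt (lt_le_trans (ut n) tx) andbF.
  have : \forall n \near \oo, x < u n by apply: cvgr_gt u_t _ xt.
  by apply: filterS => n xun /=; rewrite !in_itv/= (ltW xun) xt.
move=> /(cvgD (cvg_cst (F 0))).
apply: cvg_trans; apply: near_eq_cvg.
have : \forall n \near \oo, 0 < u n by apply: cvgr_gt u_t _ t0.
apply: filterS => n un0; change (F 0 + \int[mu]_(v in `]0, u n]) f v = F (u n)).
rewrite -density_F0// ?ltW//.
by apply: lt_trans tt; rewrite lte_fin.
Qed.

Let below_measurable : measurable [set v : R | 0 < v /\ (v%:E < tG G)%E].
Proof.
case: (tG G) => [t| |].
- rewrite (_ : [set _ | _] = `]0, t[%classic); first exact: measurable_itv.
  by apply/seteqP; split => v; rewrite /= in_itv/= lte_fin => /andP.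
- rewrite (_ : [set _ | _] = `]0, +oo[%classic); first exact: measurable_itv.
  by apply/seteqP; split => v; rewrite /= in_itv/= andbT ltry => // -[].
- by rewrite (_ : [set _ | _] = set0)//; apply/seteqP; split => v //= [].
Qed.

Lemma AG_below (v : R) : 0 < v -> (v%:E < tG G)%E ->
  AG G F f v = F 0 + \int[mu]_(u in `]0, v[) f u - f v * (1 - G v).
Proof.
move=> v0 vt; rewrite /AG vt /left_lim /left_nbhs; congr (_ - _).
by apply/cvg_lim => //; exact: density_cvg_left.
Qed.

Lemma AG_above (v : R) : (tG G <= v%:E)%E -> AG G F f v =
  if `[< cvg (F @ left_nbhs (tG G)) >] && (0 < jump_tG G) then left_lim F (tG G) else 0.
Proof. by move=> tv; rewrite /AG ltNge tv. Qed.

Lemma AG_measurable : measurable_fun (`]0, +oo[ : set R) (AG G F f).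
Proof.
pose D1 := [set v : R | 0 < v /\ (v%:E < tG G)%E].
pose D2 := `]0, +oo[ `\` D1 : set R.
have -> : `]0, +oo[%classic = D1 `|` D2 :> set R.
  by rewrite /D2 setDUK// => v -[v0 _]; rewrite /= in_itv/= v0.
apply/measurable_funU; [exact: below_measurable|by apply: measurableD => //; exact: below_measurable|].
split; last first.
  apply: (@eq_measurable_fun _ _ _ _ _ (cst
     (if `[< cvg (F @ left_nbhs (tG G)) >] && (0 < jump_tG G) then left_lim F (tG G) else 0))).
    move=> v; rewrite inE /D2/= in_itv/= andbT => -[v0 nD1]; rewrite AG_above//.
    by rewrite leNgt; apply/negP => vt; exact: nD1.
  exact: measurable_cst.
pose lF (v : R) : R := F 0 + \int[mu]_(u in `]0, v[) f u.
apply: (@eq_measurable_fun _ _ _ _ _ (fun v => lF v - f v * (1 - G v))).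
  by move=> v; rewrite inE => -[v0 vt]; rewrite AG_below.
have [mf _] := densf.
have D1sub : D1 `<=` `]0, +oo[ by move=> v [v0 _]; rewrite /= in_itv/= v0.
apply: measurable_funB; last first.
  apply: measurable_funM; first exact: measurable_funS mf.
  apply: measurable_funB => //; apply: nondecreasing_measurable => //.
  exact: cumulative_is_nondecreasing.
(* The points v (1 - 1 / (n + 1)) tend to v from below and stay in [0, v[, where F
   is measurable. *)
apply: (@measurable_fun_cvg _ _ _ _ (fun (n : nat) (v : R) => F (v * (1 - n.+1%:R^-1)))).
  move=> n; apply: (@measurable_comp _ _ _ R R R (`[0, +oo[%classic : set R) F D1
     (fun v : R => v * (1 - n.+1%:R^-1))) => //.
    move=> _ [v [v0 _] <-]; rewrite /= in_itv/= andbT; apply: mulr_ge0; first exact: ltW.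
    by rewrite subr_ge0 invf_le1// ler1n.
  exact: measurable_funM.
move=> v [v0 vt]; have /cvg_at_leftP := density_cvg_left v0 vt; apply; split.
  by move=> n; rewrite gtr_pMr// gtrBl invr_gt0.
rewrite -[X in _ --> X]mulr1; apply: cvgM; first exact: cvg_cst.
rewrite -[X in _ --> X]subr0; apply: cvgB; first exact: cvg_cst.
exact: cvg_harmonic.
Qed.

Lemma AG_bound (b v : R) : (b%:E < tG G)%E -> 0 < v -> v <= b ->
  `|AG G F f v| <= `|F 0| + \int[mu]_(u in `]0, b]) `|f u| + `|f v|.
Proof.
move=> bt v0 vb; have vt : (v%:E < tG G)%E by apply: le_lt_trans bt; rewrite lee_fin.
rewrite AG_below// (le_trans (ler_normB _ _))// lerD//.
  rewrite (le_trans (ler_normD _ _))// lerD//.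
  have mv : measurable (`]0, v[%classic : set T) by exact: measurable_itv.
  have mb : measurable (`]0, b]%classic : set T) by exact: measurable_itv.
  have vb' : `]0, v[%classic `<=` `]0, b]%classic.
    by move=> u /=; rewrite !in_itv/= => /andP[-> /ltW/le_trans]; exact.
  have iv : mu.-integrable `]0, v[ (EFin \o f).
    exact: (integrableS mb mv vb' (density_integrable bt)).
  rewrite (le_trans (le_normr_Rintegral mv iv))//.
  have ib := density_integrable bt; have inb := integrable_norm ib.
  rewrite /Rintegral fine_le//.
  - by apply: integrable_fin_num => //; exact: integrable_norm iv.
  - exact: integrable_fin_num.
  - apply: ge0_subset_integral => //.
    by have /integrableP[] := inb.
rewrite normrM ler_piMr// ger0_norm ?subr_ge0// gerBl.
exact/Gge0/ltW.
Qed.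

Lemma AG_integrable (b : R) : (b%:E < tG G)%E -> mu.-integrable `]0, b] (EFin \o AG G F f).
Proof.
move=> bt; have mb : measurable (`]0, b]%classic : set T) by exact: measurable_itv.
have ib := density_integrable bt; have inb := integrable_norm ib.
apply: (@le_integrable _ _ _ mu _ mb _ (EFin \o
   (fun v => `|F 0| + \int[mu]_(u in `]0, b]) `|f u| + `|f v|))).
- apply/measurable_EFinP; apply: (measurable_funS _ _ AG_measurable) => //.
  by move=> v /=; rewrite !in_itv/= => /andP[->].
- move=> v /=; rewrite in_itv/= => /andP[v0 vb]; rewrite lee_fin.
  by rewrite (le_trans (AG_bound bt v0 vb))// ler_norm.
- by apply: integrable_EFinD => //; exact: finite_measure_integrable_cst.
Qed.

(** Integration by parts of F against 1 - G: with F(v-) = F(0) plus the integral of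
    f over ]0, v[, fubini_triangle turns the integral of F(v-) into that of
    f(u) (G(t) - G(u)), and the terms in f(u) G(u) cancel. *)
Lemma AG_mean (t : R) : 0 <= t -> (t%:E < tG G)%E ->
  F t * (1 - G t) + \int[mu]_(v in `]0, t]) AG G F f v = F 0.
Proof.
move=> t0 tt; have mt : measurable (`]0, t]%classic : set T) by exact: measurable_itv.
have it := density_integrable tt; have iA := AG_integrable tt.
pose g v := \int[mu]_(u in `]0, v[) f u.
have iGf (c : R) : mu.-integrable `]0, t] (EFin \o (fun v => f v * (c - G v))).
  apply: (@le_integrable _ _ _ mu _ mt _ (EFin \o (fun v => (`|c| + 1) * `|f v|))).
  - apply/measurable_EFinP/measurable_funM; first by have /integrableP[/measurable_EFinP] := it.
    apply: measurable_funB => //; apply: nondecreasing_measurable => //.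
    exact: cumulative_is_nondecreasing.
  - move=> v /=; rewrite in_itv/= => /andP[/ltW v0 vt]; rewrite lee_fin.
    rewrite [leLHS]normrM [leRHS]normrM normr_id mulrC ler_wpM2r//.
    rewrite [leRHS]ger0_norm ?addr_ge0// (le_trans (ler_normB _ _))// lerD//.
    by rewrite ger0_norm// Gge0.
  - by apply: integrable_EFinZ => //; exact: integrable_norm.
have AE v : v \in (`]0, t]%classic : set R) -> AG G F f v = F 0 + g v - f v * (1 - G v).
  rewrite inE /= in_itv/= => /andP[v0 vt]; rewrite AG_below//.
  by apply: le_lt_trans tt; rewrite lee_fin.
have igF : mu.-integrable `]0, t] (EFin \o (fun v => F 0 + g v)).
  apply: (@eq_integrable _ _ _ mu _ mt (EFin \o (fun v => AG G F f v + f v * (1 - G v)))).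
    by move=> v vt; rewrite /= AE// subrK.
  exact: integrable_EFinD.
have icst : mu.-integrable `]0, t] (EFin \o cst (F 0)) by exact: finite_measure_integrable_cst.
have ig : mu.-integrable `]0, t] (EFin \o g).
  apply: (@eq_integrable _ _ _ mu _ mt (EFin \o (fun v => F 0 + g v - F 0))).
    by move=> v vt; rewrite /= addrAC subrr add0r.
  exact: integrable_EFinB.
rewrite (@eq_Rintegral _ _ _ mu _ (fun v => F 0 + g v - f v * (1 - G v))); last exact: AE.
rewrite RintegralB// RintegralD// Rintegral_cst// fubini_triangle//.
rewrite (_ : \int[_]_(u in _) _ = \int[mu]_(u in `]0, t]) (f u * (1 - G u) - (1 - G t) * f u)); last first.
  by apply: eq_Rintegral => u _; ring.
rewrite RintegralB//; last exact: integrable_EFinZ.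
rewrite RintegralZl//.
have -> : fine (mu (`]0, t]%classic : set T)) = G t.
  transitivity (fine (G t - G 0)%:E); last by rewrite G0 subr0.
  by congr fine; exact: stieltjes_itv.
by rewrite (density_F0 t0 tt); ring.
Qed.

End local_density.

(** * The process before t_G *)

Section paths.
Context {R : realType}.

Lemma is_cvg_near_eq {U : Type} (H : set_system U) {FH : Filter H} (f g : U -> R) :
  (\forall x \near H, f x = g x) -> cvg (f x @[x --> H]) -> cvg (g x @[x --> H]).
Proof.
move=> fg /cvg_ex[l fl]; apply/cvg_ex; exists l.
by apply: cvg_trans fl; apply: near_eq_cvg; apply: filterS fg => x.
Qed.

(** The regularity of phi is required only up to the jump g, after which the path is
    constant; this is why at t = g only the left limit of phi matters. *)
Lemma cadlag_single_jump (T : \bar R) (g c : R) (phi : R -> R) (x : \bar R -> R) :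
  0 < g ->
  (forall t, 0 <= t -> (t%:E < T)%E -> t < g -> phi s @[s --> t^'+] --> phi t) ->
  (forall t, 0 < t -> (t%:E <= T)%E -> t <= g -> cvg (phi s @[s --> t^'-])) ->
  (forall t, (0 <= t <= T)%E -> x t = if (t < g%:E)%E then phi (fine t) else c) ->
  cadlag_on T x.
Proof.
move=> g0 phi_right phi_left xE.
apply: (@cadlag_on_eq _ _ (fun t => if (t < g%:E)%E then phi (fine t) else c)) => //.
split=> [t t0 tT|t /andP[t0 tT]].
  rewrite lte_fin; case: ltP => [tg|gt]; last first.
    apply: cvg_near_cst; near=> s; rewrite lte_fin ltNge (le_trans gt)//.
  apply: cvg_trans (phi_right t t0 tT tg); apply: near_eq_cvg; near=> s.
  by rewrite lte_fin ifT//; near: s; exact: nbhs_right_lt.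
have [tg|gt] := leP t g%:E; last first.
  apply: (@is_cvg_near_eq _ _ _ (cst c)); last exact: is_cvg_cst.
  apply: filterS (near_left_nbhs gt) => s [gs _].
  by rewrite lte_fin ltNge (ltW gs).
case: t t0 tT tg => [t| |]//; rewrite lte_fin lee_fin => t0 tT tg.
rewrite /left_nbhs; apply: (@is_cvg_near_eq _ _ _ phi); last exact: phi_left.
apply: filterS (nbhs_left_lt t) => s st.
by rewrite lte_fin (lt_le_trans st tg).
Unshelve. all: by end_near. Qed.

End paths.

Section single_jump_process.
Context {R : realType} {d : measure_display} {Omega : measurableType d}.
Variables (P : probability Omega R) (G : cumulativeBounded (0 : R) (1 : R)).
Hypothesis G0 : G 0 = 0.
Variable gamma : {RV P >-> R}.
Hypothesis gamma0 : forall w, 0 < gamma w.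
Hypothesis hgamma : forall t : R, cdf gamma t = (G t)%:E.
Variables (F f : R -> R).
Hypothesis mF : measurable_fun (`[0, +oo[ : set R) F.
Hypothesis densf : is_local_density G F f.
Let mu : probability (measurableTypeR R) R := lebesgue_stieltjes_measure G.
Let M := MG gamma G F f.
Let FF := single_jump_filtration gamma.

Let mgamma : measurable_fun setT gamma.
Proof. exact: (@measurable_funP _ _ _ _ setT gamma). Qed.

Let Gle1 t : G t <= 1. Proof. exact: G_le1 hgamma t. Qed.

Let tG0 : (0 < tG G)%E. Proof. exact: (@tG_gt0 _ _ _ P G G0 gamma hgamma). Qed.

Let FFis : is_filtration FF. Proof. exact: single_jump_filtration_is. Qed.

Let before (t : R) := [set w | gamma w <= t].

Let mbefore t : measurable (before t).
Proof.
have := mgamma measurableT (measurable_itv `]-oo, t]); rewrite setTI.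
by rewrite (_ : before t = gamma @^-1` `]-oo, t])//; apply/seteqP; split => w; rewrite /= in_itv.
Qed.

Lemma MG_after t w : ((gamma w)%:E <= t)%E -> M t w = AG G F f (gamma w).
Proof. by rewrite /M /MG leNgt => /negbTE ->. Qed.

Lemma MG_before (t : R) w : t < gamma w -> M t%:E w = F t.
Proof. by rewrite /M /MG lte_fin => ->. Qed.

Lemma MG_measurable_wrt t : measurable_wrt (FF t) (M t).
Proof. apply: measurable_wrt_single_jump => //; exact: AG_measurable mF densf. Qed.

Lemma MG_measurable t : (0 <= t)%E -> measurable_fun setT (M t).
Proof.
by move=> t0; have [_ FFm _] := FFis; exact: measurable_wrt_sub (FFm _ t0) (@MG_measurable_wrt t).
Qed.

Lemma natural_subfiltration : subfiltration (natural_filtration M) FF.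
Proof.
move=> t t0; apply: smallest_sub; first exact: single_jump_sigma.
move=> B [s /andP[s0 st] sB]; apply: (single_jump_mono st).
exact: MG_measurable_wrt sB.
Qed.

Lemma before_preimage t : gamma @^-1` `]0, t] = before t.
Proof. by apply/seteqP; split => w; rewrite /= in_itv/= gamma0. Qed.

Lemma MG_integrable_mean (t : R) : 0 <= t -> (t%:E < tG G)%E ->
  P.-integrable setT (EFin \o M t%:E) /\ \int[P]_w M t%:E w = F 0.
Proof.
move=> t0 tt; have mt : measurable (`]0, t]%classic : set R) by exact: measurable_itv.
have iA := AG_integrable G0 Gle1 mF densf tt.
have mA : measurable_fun (`]0, t] : set R) (AG G F f).
  apply: (measurable_funS _ _ (AG_measurable mF densf)) => //.
  by move=> v /=; rewrite !in_itv/= => /andP[->].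
have := (law_integrable hgamma mt mA).1 iA; rewrite before_preimage => iAg.
have iAg0 : P.-integrable setT (EFin \o ((AG G F f \o gamma) \_ (before t))).
  by rewrite -restrict_EFin; exact: ((integrable_mkcond _ (mbefore t)).1 iAg).
have i1 : P.-integrable setT (EFin \o (\1_(~` before t) : Omega -> R)).
  by apply: integrable_indic; exact: measurableC.
have ME : M t%:E = fun w => ((AG G F f \o gamma) \_ (before t)) w + F t * \1_(~` before t) w.
  apply/funext => w; rewrite patchE indicE in_setC.
  case: (boolP (w \in before t)) => /=.
    by rewrite inE => wt; rewrite mulr0 addr0 MG_after// lee_fin.
  rewrite notin_setE/= => /negP; rewrite -ltNge => tw.
  by rewrite MG_before// mulr1; exact/esym/add0r.
rewrite ME; split; first by apply: integrable_EFinD => //; exact: integrable_EFinZ.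
rewrite RintegralD//; last exact: integrable_EFinZ.
rewrite RintegralZl// -Rintegral_mkcond.
rewrite -before_preimage -(law_Rintegral hgamma mt iA) before_preimage.
have -> : \int[P]_w (\1_(~` before t) w : R) = 1 - G t.
  have PC : P (~` before t) = (1 - (G t)%:E)%E.
    by rewrite probability_setC// /before (prob_gamma_le hgamma).
  rewrite /Rintegral integral_indic//; last exact: measurableC.
  by rewrite setIT; transitivity (fine (P (~` before t))) => //; rewrite PC -EFinB.
by rewrite addrC; exact: (AG_mean G0 Gle1 mF densf t0 tt).
Qed.

Let time_fin (t : \bar R) (b : R) : (0 <= t)%E -> 0 <= b ->
  exists s, [/\ mine t b%:E = s%:E, 0 <= s & s <= b].
Proof.
case: t => [t| |]// t0 b0; last by exists b; rewrite minye.
exists (Num.min t b); rewrite EFin_min; split => //.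
  by rewrite le_min -lee_fin t0.
by rewrite ge_min lexx orbT.
Qed.

Lemma MG_stopped_martingale (b : R) : 0 <= b -> (b%:E < tG G)%E ->
  martingale_on P (tG G) FF (fun t => M (mine t b%:E)).
Proof.
move=> b0 bt.
have min0 t : (0 <= t)%E -> (0 <= mine t b%:E)%E by move=> t0; rewrite le_min t0 lee_fin.
apply: (martingale_of_constant_mean mgamma (m := F 0)).
- apply: aeW => w.
  apply: (@cadlag_single_jump _ _ (gamma w) (M (mine (gamma w)%:E b%:E) w)
    (fun t => F (Num.min t b))) => //.
  + move=> t t0 tt tg; have [tb|bt'] := ltP t b.
      apply: cvg_trans (density_cvg_right densf t0 tt); apply: near_eq_cvg.
      near=> s; rewrite min_l//; apply: ltW; near: s; exact: nbhs_right_lt.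
    apply: cvg_near_cst; near=> s; rewrite min_r//.
    by rewrite (le_trans bt')//; apply: ltW; near: s; exact: nbhs_right_gt.
  + move=> t t0 _ tg; have [tb|bt'] := leP t b.
      apply: (is_cvg_near_eq (f := F)).
        near=> s; rewrite min_l// (le_trans _ tb)//.
      apply/cvg_ex; eexists; apply: (density_cvg_left densf t0).
      by apply: le_lt_trans bt; rewrite lee_fin.
    apply: (is_cvg_near_eq (f := cst (F b))); last exact: is_cvg_cst.
    near=> s; rewrite min_r//.
    by apply: ltW; near: s; exact: nbhs_left_gt.
  + move=> t /andP[t0 _]; case: ltP => [|gt].
      case: t t0 => [t| |]// t0; rewrite lte_fin => tg.
      by rewrite -EFin_min MG_before//= gt_min tg.
    have [gb|bg] := leP (gamma w) b.
      by rewrite [in RHS]min_l ?lee_fin// !MG_after// le_min gt lee_fin.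
    have bgE : (b%:E <= (gamma w)%:E)%E by rewrite lee_fin ltW.
    by rewrite (min_r bgE) (min_r (le_trans bgE gt)).
- move=> t /andP[t0 _]; apply: measurable_wrt_mono (@MG_measurable_wrt _).
  by apply: single_jump_mono; rewrite ge_min lexx.
- move=> t /andP[t0 _]; have [s [-> s0 sb]] := time_fin t0 b0.
  by case: (MG_integrable_mean s0 (le_lt_trans _ bt)) => //; rewrite lee_fin.
- move=> s u w s0 su _ ws; have [gb|bg] := leP (gamma w) b.
    by rewrite !MG_after// le_min ?ws ?(le_trans ws su) lee_fin.
  have bs : (b%:E <= s)%E by apply: le_trans ws; rewrite lee_fin ltW.
  by rewrite (min_r bs) (min_r (le_trans bs su)).
- move=> t /andP[t0 _]; have [s [-> s0 sb]] := time_fin t0 b0.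
  by case: (MG_integrable_mean s0 (le_lt_trans _ bt)) => //; rewrite lee_fin.
Unshelve. all: by end_near. Qed.

Lemma tG_approx : exists c : nat -> R, [/\ {homo c : i j / (i <= j)%N >-> i <= j},
  forall n, 0 <= c n, forall n, ((c n)%:E < tG G)%E &
  forall x : R, (x%:E < tG G)%E -> exists n, x <= c n].
Proof.
move: tG0; case: (tG G) => [r| |]// r0; last first.
  exists (fun n => n%:R); split => [i j ij|n|n|x _].
  - by rewrite ler_nat.
  - exact: ler0n.
  - exact: ltry.
  - exists (Num.bound `|x|); apply: le_trans (ler_norm _) _.
    exact/ltW/archi_boundP.
have {}r0 : 0 < r by [].
exists (fun n => r - r / n.+1%:R); split => [i j ij|n|n|x].
- by rewrite lerD2l lerN2 ler_pM2l// lef_pV2 ?posrE ?ltr0n// ler_nat.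
- by rewrite subr_ge0 ler_pdivrMr ?ltr0n// ler_peMr ?ler1n// ltW.
- by rewrite lte_fin ltrBlDr ltrDl divr_gt0.
rewrite lte_fin => xr; have xr0 : 0 < r - x by rewrite subr_gt0.
exists (Num.bound (r / (r - x))); rewrite lerBrDr -lerBrDl ler_pdivrMr// mulrC -ler_pdivrMr//.
apply: le_trans (ltW (archi_boundP _)) _; last by rewrite ler_nat.
by rewrite divr_ge0// ltW.
Qed.

Let mbelow : measurable [set w | ((gamma w)%:E < tG G)%E].
Proof.
have [c [_ _ ct cx]] := tG_approx.
rewrite (_ : [set _ | _] = \bigcup_n before (c n)).
  by apply: bigcup_measurable => n _.
apply/seteqP; split => [w /= /cx[n wn]|w [n _ wn]]; first by exists n.
by apply: le_lt_trans (ct n); rewrite lee_fin.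
Qed.

(** A monotone bounded function has left limits. *)
Lemma left_lim_G (r : R) : tG G = r%:E -> G s @[s --> r^'-] --> left_lim G (tG G).
Proof.
move=> tGr; rewrite tGr /left_lim /left_nbhs; apply: nondecreasing_at_left_is_cvgr.
  by near=> s => x y _ _; exact: G_nd.
by near=> s; exists 1 => _ [y _ <-]; exact: Gle1.
Unshelve. all: by end_near. Qed.

Lemma jump_infty : tG G = +oo%E -> jump_tG G = 0.
Proof.
move=> tGy; rewrite /jump_tG tGy /extG /left_lim /left_nbhs.
have /cvg_lim -> : G s @[s --> +oo] --> (1 : R) by exact: cumulativey.
by rewrite subrr.
by [].
Qed.

Lemma prob_below (r : R) : tG G = r%:E ->
  P [set w | ((gamma w)%:E < tG G)%E] = (1 - jump_tG G)%:E.
Proof.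
move=> tGr; have [c [c_mono c0 ct cx]] := tG_approx.
have -> : [set w | ((gamma w)%:E < tG G)%E] = \bigcup_n before (c n).
  apply/seteqP; split => [w /= /cx[n wn]|w [n _ wn]]; first by exists n.
  by apply: le_lt_trans (ct n); rewrite lee_fin.
have Pc : P \o (fun n => before (c n)) @ \oo --> P (\bigcup_n before (c n)).
  apply: nondecreasing_cvg_mu => //; first by apply: bigcup_measurable.
  by move=> i j ij; apply/subsetPset => w /= /le_trans; apply; exact: c_mono.
have c_r : c n @[n --> \oo] --> r.
  apply/cvgrPdist_lt => e e0.
  have [|N rN] := cx (r - e / 2); first by rewrite tGr lte_fin gtrBl divr_gt0.
  exists N => // n /= Nn; rewrite ger0_norm ?subr_ge0; last first.
    by have := ct n; rewrite tGr lte_fin => /ltW.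
  rewrite ltrBlDr -ltrBlDl; apply: (@lt_le_trans _ _ (c N)); last exact: c_mono.
  by apply: lt_le_trans rN; rewrite ltrD2l ltrN2 ltr_pdivrMr// ltr_pMr// ltr1n.
have Gc : (fun n => (G (c n))%:E) @ \oo --> (left_lim G (tG G))%:E.
  apply/cvg_EFin; first exact: nearW.
  have /cvg_at_leftP := left_lim_G tGr; apply; split => // n.
  by have := ct n; rewrite tGr.
have PG : P \o (fun n => before (c n)) = fun n => (G (c n))%:E.
  by apply/funext => n /=; exact: (prob_gamma_le hgamma).
rewrite PG in Pc; rewrite (cvg_unique _ Pc Gc)//; congr EFin.
rewrite /jump_tG [in extG _ _]tGr /= (G_eq1 G0 hgamma); last by rewrite tGr.
by rewrite opprB addrC subrK.
Qed.

Lemma gamma_lt_tG : jump_tG G = 0 -> {ae P, forall w, ((gamma w)%:E < tG G)%E}.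
Proof.
move=> jump0; case tGE : (tG G) => [r| |]; last 2 first.
- by apply: aeW => w; rewrite ltry.
- by move: tG0; rewrite tGE.
exists (~` [set w | ((gamma w)%:E < tG G)%E]); split; first exact: measurableC.
  have := prob_below tGE; rewrite jump0 subr0 => P1.
  by rewrite probability_setC// P1 subee.
by rewrite tGE.
Qed.

(** * No atom at t_G *)

Let natural_sigma t : sigma_algebra setT (natural_filtration M t).
Proof. exact: smallest_sigma_algebra. Qed.

Let natural_mono s t : (s <= t)%E -> natural_filtration M s `<=` natural_filtration M t.
Proof.
move=> st; apply: smallest_sub; first exact: natural_sigma.
move=> B [u /andP[u0 us] uB]; apply: sub_sigma_algebra; exists u => //=.
by rewrite u0 (le_trans us).
Qed.

Let natural0 t : natural_filtration M t set0.
Proof. by case: (natural_sigma t). Qed.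

Let naturalT t : natural_filtration M t setT.
Proof. by have [n0 nC _] := natural_sigma t; rewrite -(setD0 setT); exact: nC. Qed.

Let MG_adapted_eq (b : R) (X : \bar R -> Omega -> R) : 0 <= b -> (b%:E < tG G)%E ->
  (forall t w, (0 <= t <= tG G)%E -> X t w = M (mine t b%:E) w) ->
  martingale_on P (tG G) FF X.
Proof.
move=> b0 bt XE; apply: (martingale_on_eq FFis _ (MG_stopped_martingale b0 bt)).
  move=> t tt; rewrite (_ : X t = M (mine t b%:E)); last by apply/funext => w; exact: XE.
  apply: measurable_wrt_mono (@MG_measurable_wrt _).
  by apply: single_jump_mono; rewrite ge_min lexx.
by apply: aeW => w t tt; exact: XE.
Qed.

(** F has no variation on [b0, b], so variation_bound applies with C = 0. *)
Lemma density_eq0 (b0 b : R) : 0 <= b0 -> b0 <= b -> (b%:E < tG G)%E ->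
  (forall t, b0 <= t -> (t%:E < tG G)%E -> F t = F b0) ->
  {ae mu, forall v, b0 < v <= b -> f v = 0}.
Proof.
move=> b00 b0b bt Fconst.
have mI : measurable (`]b0, b]%classic : set (measurableTypeR R)) by exact: measurable_itv.
have i0 : mu.-integrable `]b0, b] (EFin \o f).
  apply: (integrableS _ mI _ (density_integrable densf bt)); first exact: measurable_itv.
  by move=> v /=; rewrite !in_itv/= => /andP[/(le_lt_trans b00) -> ->].
have tt t : t <= b -> (t%:E < tG G)%E by move=> tb; apply: le_lt_trans bt; rewrite lee_fin.
have := @variation_bound _ mu f F b0 b 0 b0b i0.
have h1 s t : b0 <= s -> s <= t -> t <= b -> F t - F s = \int[mu]_(v in `]s, t]) f v.
  by move=> b0s st tb; apply: (density_FB densf) => //; [exact: le_trans b0s|exact: tt].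
have h2 n (x : nat -> R) : {homo x : i j / (i <= j)%N >-> i <= j} ->
    (forall i, b0 <= x i <= b) -> \sum_(i < n) `|F (x i.+1) - F (x i)| <= 0.
  move=> _ xb; rewrite big1// => i _.
  have /andP[l1 u1] := xb i; have /andP[l2 u2] := xb i.+1.
  by rewrite !Fconst ?tt// subrr normr0.
move=> /(_ h1 h2) int0.
have inf := integrable_norm i0.
have int0E : (\int[mu]_(v in `]b0, b]) `|(EFin \o f) v| = 0)%E.
  rewrite -[LHS]fineK; last exact: (integrable_fin_num mI inf).
  by congr EFin; apply/le_anti; rewrite int0 Rintegral_ge0.
have mf0 : measurable_fun (`]b0, b]%classic : set (measurableTypeR R)) (EFin \o f).
  by have /integrableP[] := i0.
have := (ae_eq_integral_abs mu mI mf0).1 int0E.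
apply: filterS => v fv vb; have /= := fv _; rewrite in_itv/= => /(_ vb) [].
exact.
Qed.

(** Beyond b0 the density vanishes at gamma almost surely, so that the value after the
    jump is the left limit of F, which is the constant F(b0). *)
Let constant_case (b0 : R) : jump_tG G = 0 -> 0 <= b0 -> (b0%:E < tG G)%E ->
  (forall t, b0 <= t -> (t%:E < tG G)%E -> F t = F b0) ->
  {ae P, forall w t, (0 <= t <= tG G)%E -> M t w = M (mine t b0%:E) w}.
Proof.
move=> jump0 b00 b0t Fconst.
have [c [c_mono c0 ct cx]] := tG_approx.
have f0 : {ae P, forall w, b0 < gamma w -> ((gamma w)%:E < tG G)%E -> f (gamma w) = 0}.
  have f0n n : {ae P, forall w, b0 < gamma w <= Num.max b0 (c n) -> f (gamma w) = 0}.
    have bc : b0 <= Num.max b0 (c n) by rewrite le_max lexx.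
    have ctm : ((Num.max b0 (c n))%:E < tG G)%E by rewrite EFin_max gt_max b0t ct.
    have [N [mN N0 fN]] := density_eq0 b00 bc ctm Fconst.
    exists (gamma @^-1` N); split.
    - by rewrite -[X in measurable X]setTI; exact: mgamma.
    - by rewrite -(stieltjes_law hgamma mN).
    - by move=> w /= h; apply: fN => /= h'; apply: h => /h'.
  have : {ae P, forall w n, b0 < gamma w <= Num.max b0 (c n) -> f (gamma w) = 0}.
    exact/ae_foralln.
  apply: filterS => w h b0g /cx[n gn]; apply: (h n).
  by rewrite b0g le_max gn orbT.
apply: filterS2 f0 (gamma_lt_tG jump0) => w f0w wt t /andP[t0 tt].
have [tb|bt] := leP t b0%:E; first by [].
have [gb|bg] := leP (gamma w) b0.
  by rewrite !MG_after ?lee_fin//; apply: le_trans (ltW bt); rewrite lee_fin.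
rewrite MG_before//.
have AGw : AG G F f (gamma w) = F b0.
  rewrite (AG_below densf)// f0w// mul0r subr0.
  have FL : F x @[x --> (gamma w)^'-] --> F b0.
    apply: cvg_near_cst; near=> s; apply: Fconst.
      by apply: ltW; near: s; exact: nbhs_left_gt.
    by apply: lt_trans wt; rewrite lte_fin; near: s; exact: nbhs_left_lt.
  exact: (cvg_unique _ (density_cvg_left densf (gamma0 w) wt) FL).
have [gt|tg] := leP (gamma w)%:E t; first by rewrite MG_after.
case: t t0 tt bt tg => [t| |]// t0 tt bt tg.
rewrite MG_before//; apply: Fconst; first by move: bt; rewrite lte_fin => /ltW.
exact: lt_trans wt.
Unshelve. all: by end_near. Qed.

Let constant_local_martingale (b0 : R) : jump_tG G = 0 -> 0 <= b0 -> (b0%:E < tG G)%E ->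
  (forall t, b0 <= t -> (t%:E < tG G)%E -> F t = F b0) ->
  local_martingale_on P (tG G) (natural_filtration M) FF M.
Proof.
move=> jump0 b00 b0t Fconst; split; first exact: natural_subfiltration.
exists (fun _ _ => tG G); split => [n t t0|n w|n w|n|].
- have [tt|tt] := leP (tG G) t.
    by rewrite (_ : [set _ | _] = setT)//; apply/seteqP; split.
  by rewrite (_ : [set _ | _] = set0)//; apply/seteqP; split.
- by rewrite lexx ltW.
- exact: lexx.
- apply: (martingale_on_eq FFis _ (MG_stopped_martingale b00 b0t)).
    move=> t /andP[_ tt]; rewrite /stopped.
    rewrite (_ : (fun w => _) = M t); first exact: MG_measurable_wrt.
    by apply/funext => w; rewrite min_l.
  apply: filterS (constant_case jump0 b00 b0t Fconst) => w Mw t tt.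
  by have /andP[_ tt'] := tt; rewrite /stopped min_l// Mw.
- rewrite (_ : (fun n => _) = cst 1%E); first exact: cvg_cst.
  apply/funext => n; rewrite (_ : [set _ | _] = setT) ?probability_setT//.
  by apply/seteqP; split.
Qed.

(** For every time b and every value a some time at or after b has F different from a;
    the sequence is built by taking for a the previous value of F. *)
Let nonconstant_times : ~ (exists b0 : R, [/\ 0 <= b0, (b0%:E < tG G)%E &
    forall t, b0 <= t -> (t%:E < tG G)%E -> F t = F b0]) ->
  exists x : nat -> R, [/\ forall n, 0 <= x n, forall n, ((x n)%:E < tG G)%E,
    forall n, x n <= x n.+1, forall n, F (x n.+1) <> F (x n) &
    forall y : R, (y%:E < tG G)%E -> exists n, y <= x n].
Proof.
move=> nconst; have [c [c_mono c0 ct cx]] := tG_approx.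
have step (ba : R * R) : exists t : R, 0 <= ba.1 -> (ba.1%:E < tG G)%E ->
    [/\ ba.1 <= t, (t%:E < tG G)%E & F t <> ba.2].
  case: ba => b a /=; have [b0|b0] := leP 0 b; last by exists 0.
  have [bt|bt] := ltP b%:E (tG G); last by exists 0.
  have [Fba|Fba] := pselect (F b = a); last by exists b.
  apply: contrapT => /forallNP nt; apply: nconst; exists b; split => // t bt' tt.
  apply: contrapT => Ft; apply: (nt t) => _ _; split => //.
  by rewrite -Fba.
have [h hP] := choice step.
pose x := fix x n := if n is n'.+1 then h (Num.max (x n') (c n'.+1), F (x n')) else c 0%N.
have xP n : 0 <= x n /\ ((x n)%:E < tG G)%E.
  elim: n => [|n [x0 xt]] /=; first by split.
  have [||[xh ht _]] := hP (Num.max (x n) (c n.+1), F (x n)) => /=.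
  - by rewrite le_max x0.
  - by rewrite EFin_max gt_max xt ct.
  - by split => //; apply: le_trans xh; rewrite /= le_max x0.
have xS n : [/\ Num.max (x n) (c n.+1) <= x n.+1, ((x n.+1)%:E < tG G)%E & F (x n.+1) <> F (x n)].
  have [x0 xt] := xP n.
  apply: (hP (Num.max (x n) (c n.+1), F (x n))) => /=.
    by rewrite le_max x0.
  by rewrite EFin_max gt_max xt ct.
exists x; split.
- by move=> n; case: (xP n).
- by move=> n; case: (xP n).
- by move=> n; have [+ _ _] := xS n; rewrite ge_max => /andP[].
- by move=> n; case: (xS n).
move=> y /cx[n yn]; exists n.+1; have [+ _ _] := xS n; rewrite ge_max => /andP[_].
by apply: le_trans; apply: (le_trans yn); exact: c_mono.
Qed.

(** On A n, M has agreed with F at x_0, ..., x_n, which the filtration of M sees at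
    time x_n. Off A n the jump has occurred, and M stopped at x_n is M. After the jump M
    is constant whereas F takes distinct values at consecutive times, so almost every
    point eventually leaves A n. *)
Let nonconstant_local_martingale (x : nat -> R) : jump_tG G = 0 ->
  (forall n, 0 <= x n) -> (forall n, ((x n)%:E < tG G)%E) ->
  (forall n, x n <= x n.+1) -> (forall n, F (x n.+1) <> F (x n)) ->
  (forall y : R, (y%:E < tG G)%E -> exists n, y <= x n) ->
  local_martingale_on P (tG G) (natural_filtration M) FF M.
Proof.
move=> jump0 x0 xt xS Fx xy; split; first exact: natural_subfiltration.
have x_mono : {homo x : i j / (i <= j)%N >-> i <= j}.
  by apply: homo_leq => //; exact: le_trans.
pose A n := [set w | forall k, (k <= n)%N -> M (x k)%:E w = F (x k)].
have nA n : natural_filtration M (x n)%:E (A n).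
  pose U := \bigcup_(s in [set s | (0 <= s <= (x n)%:E)%E])
        preimage_set_system setT (M s) measurable.
  have : measurable (\bigcap_(k in [set k | (k <= n)%N])
       (M (x k)%:E @^-1` [set F (x k)]) : set (g_sigma_algebraType U)).
    apply: bigcap_measurable => [|k /= kn]; first by exists 0%N.
    apply: sub_sigma_algebra; exists (x k)%:E.
      by rewrite /= !lee_fin x0 x_mono.
    by exists [set F (x k)]; rewrite ?setTI.
  by rewrite (_ : \bigcap_(k in _) _ = A n).
have mA n : measurable (A n).
  have [_ FFm _] := FFis; apply: (FFm (x n)%:E); first by rewrite lee_fin.
  by apply: natural_subfiltration (nA n); rewrite lee_fin.
have AS n : A n.+1 `<=` A n by move=> w Aw k kn; apply: Aw; exact: leqW.
have notA n w : ~ A n w -> ((gamma w)%:E <= (x n)%:E)%E.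
  move=> nAw; rewrite leNgt; apply/negP; rewrite lte_fin => xg; apply: nAw => k kn.
  by rewrite MG_before// (le_lt_trans _ xg)// x_mono.
pose tau n w := if w \in A n then (x n)%:E else tG G.
have tauA n w : A n w -> tau n w = (x n)%:E by move=> Aw; rewrite /tau mem_set.
have tauN n w : ~ A n w -> tau n w = tG G by move=> Aw; rewrite /tau memNset.
have tau_eq n : [set w | tau n w = tG G] = ~` A n.
  apply/seteqP; split => w /=; last exact: tauN.
  by move=> tw Aw; have := xt n; rewrite -(tauA _ _ Aw) tw ltxx.
exists tau; split => [n t t0|n w|n w|n|].
- have [tt|tt] := leP (tG G) t.
    rewrite (_ : [set _ | _] = setT)//; apply/seteqP; split => // w _ /=.
    by rewrite /tau; case: ifP => _ //; rewrite (le_trans (ltW (xt n))).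
  have [xnt|txn] := leP (x n)%:E t.
    rewrite (_ : [set _ | _] = A n); first exact: natural_mono (nA n).
    apply/seteqP; split => w /=; last by move=> Aw; rewrite tauA.
    move=> tw; apply: contrapT => nAw; move: tw; rewrite tauN// leNgt tt//.
  rewrite (_ : [set _ | _] = set0)//; apply/seteqP; split => // w /=.
  by rewrite /tau; case: ifP => _; rewrite leNgt ?txn ?tt.
- by rewrite /tau; case: ifP => _; [rewrite lee_fin x0 ltW|rewrite lexx ltW].
- have [Aw|nAw] := pselect (A n.+1 w).
    by rewrite (tauA _ _ Aw) (tauA n)//; [rewrite lee_fin|exact: AS].
  by rewrite (tauN _ _ nAw) /tau; case: ifP => _ //; exact: ltW.
- apply: (MG_adapted_eq (x0 n) (xt n)) => t w /andP[t0 tt]; rewrite /stopped.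
  have [Aw|nAw] := pselect (A n w); first by rewrite tauA.
  rewrite tauN// (min_l tt); have [//|xnt] := leP t (x n)%:E.
  by rewrite !MG_after ?(notA n)// (le_trans (notA n _ _) (ltW xnt)).
under eq_fun do rewrite tau_eq.
have P1 : P (\bigcup_n ~` A n) = 1%E.
  have mU : measurable (\bigcup_n ~` A n).
    by apply: bigcup_measurable => n _; exact: measurableC.
  have PC0 : P (~` (\bigcup_n ~` A n)) = 0%E.
    apply/negligibleP; first exact: measurableC.
    apply: negligibleS (gamma_lt_tG jump0) => w nU /= /xy[n gn]; apply: nU.
    exists n.+1 => // Aw.
    have gS : gamma w <= x n.+1 by rewrite (le_trans gn).
    apply: (Fx n); rewrite -(Aw n.+1 (leqnn _)) -(Aw n (leqnSn n)).
    by rewrite !MG_after// lee_fin.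
  by rewrite -[\bigcup_n _]setCK probability_setC ?PC0 ?sube0//; exact: measurableC.
rewrite -P1; apply: nondecreasing_cvg_mu.
- by move=> n; exact: measurableC.
- by apply: bigcup_measurable => n _; exact: measurableC.
- by apply/nondecreasing_seqP => n; apply/subsetPset => w nA' Aw; apply: nA'; exact: AS.
Qed.

Theorem MG_local_martingale : jump_tG G = 0 ->
  local_martingale_on P (tG G) (natural_filtration M) FF M.
Proof.
move=> jump0.
have [[b0 [b00 b0t Fb0]]|nconst] := pselect (exists b0 : R, [/\ 0 <= b0, (b0%:E < tG G)%E &
    forall t, b0 <= t -> (t%:E < tG G)%E -> F t = F b0]).
  exact: constant_local_martingale Fb0.
have [x [x0 xt xS Fx xy]] := nonconstant_times nconst.
exact: nonconstant_local_martingale Fx xy.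
Qed.

(** * An atom at t_G *)

Section atom.
Hypothesis jump_gt0 : 0 < jump_tG G.

Lemma tG_real : exists2 r, tG G = r%:E & 0 < r.
Proof.
move: tG0; case tGE : (tG G) => [r| |]//; last by move: jump_gt0; rewrite jump_infty// ltxx.
by rewrite lte_fin => r0; exists r.
Qed.

Lemma jump_le (t : R) : (t%:E < tG G)%E -> jump_tG G <= 1 - G t.
Proof.
move=> tt; have [r tGr r0] := tG_real.
rewrite /jump_tG [in extG _ _]tGr /= (G_eq1 G0 hgamma); last by rewrite tGr.
rewrite lerD2l lerN2; apply: limr_ge.
- by rewrite tGr /left_nbhs; exact: at_left_proper_filter.
- by apply/cvg_ex; eexists; rewrite {1}tGr; exact: left_lim_G.
rewrite tGr /left_nbhs; near=> s; apply: G_nd; apply: ltW; near: s.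
by apply: nbhs_left_gt; move: tt; rewrite tGr.
Unshelve. all: by end_near. Qed.

Section integrable_terminal_value.
Variable r : R.
Hypotheses (tGr : tG G = r%:E) (r0 : 0 < r).
Hypothesis iM : P.-integrable setT (EFin \o M r%:E).

(** M at time t is F(t) before the jump and already M at time r after it, so that the
    constant mean expresses F(t) by the terminal value. *)
Let MG_split (t : R) : 0 <= t -> t < r ->
  F t * (1 - G t) + \int[P]_(w in before t) M r%:E w = F 0.
Proof.
move=> t0 tr; have tt : (t%:E < tG G)%E by rewrite tGr.
have [iMt <-] := MG_integrable_mean t0 tt.
have mC : measurable (~` before t) by exact: measurableC.
have -> : \int[P]_w M t%:E w =
    \int[P]_(w in before t) M t%:E w + \int[P]_(w in ~` before t) M t%:E w.
  rewrite -Rintegral_setU ?setvU// ?setUv//.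
  by rewrite disj_set2E setICr.
rewrite addrC; congr (_ + _).
  by apply: eq_Rintegral => w; rewrite inE => wt; rewrite !MG_after ?lee_fin// (le_trans wt)// ltW.
rewrite (@eq_Rintegral _ _ _ P _ (cst (F t))); last first.
  move=> w; rewrite inE => /= /negP; rewrite -ltNge => tw.
  by rewrite MG_before.
rewrite Rintegral_cst//; congr (_ * _).
have PC : P (~` before t) = (1 - (G t)%:E)%E.
  by rewrite probability_setC// /before (prob_gamma_le hgamma).
by transitivity (fine (P (~` before t))) => //; rewrite PC -EFinB.
Qed.

Let bound := (`|F 0| + \int[P]_w `|M r%:E w|) / jump_tG G.

Let F_bound (t : R) : 0 <= t -> t < r -> `|F t| <= bound.
Proof.
move=> t0 tr; rewrite /bound ler_pdivlMr//.
have jt : jump_tG G <= 1 - G t by apply: jump_le; rewrite tGr.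
apply: (@le_trans _ _ `|F t * (1 - G t)|).
  by rewrite normrM ler_wpM2l// (le_trans jt)// ler_norm.
have -> : F t * (1 - G t) = F 0 - \int[P]_(w in before t) M r%:E w.
  by rewrite -(MG_split t0 tr) addrK.
rewrite (le_trans (ler_normB _ _))// lerD2l.
have ib : P.-integrable (before t) (EFin \o M r%:E) by exact: integrableS iM.
have inM := integrable_norm iM.
rewrite (le_trans (le_normr_Rintegral _ ib))//.
rewrite /Rintegral fine_le//.
- by apply: integrable_fin_num => //; exact: integrable_norm ib.
- exact: integrable_fin_num.
- by apply: ge0_subset_integral => //; have /integrableP[] := inM.
Qed.

Let below := [set w | gamma w < r].

Let mbelow_real : measurable below.
Proof.
rewrite (_ : below = [set w | ((gamma w)%:E < tG G)%E])//.
by apply/seteqP; split => w; rewrite /below /= tGr lte_fin.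
Qed.

Let F_left_lim : F s @[s --> r^'-] --> (F 0 - \int[P]_(w in below) M r%:E w) / jump_tG G.
Proof.
apply/cvg_at_leftP => u [ur u_r].
have Gu : G (u n) @[n --> \oo] --> 1 - jump_tG G.
  have -> : 1 - jump_tG G = left_lim G (tG G).
    rewrite /jump_tG [in extG _ _]tGr /= (G_eq1 G0 hgamma); last by rewrite tGr.
    by rewrite opprB addrC subrK.
  by have /cvg_at_leftP := left_lim_G tGr; apply.
have Iu : \int[P]_(w in before (u n)) M r%:E w @[n --> \oo] -->
    \int[P]_(w in below) M r%:E w.
  apply: (@cvg_Rintegral_sets _ _ _ P setT) => //.
  move=> w; have [wr|rw] := ltP (gamma w) r.
    have : \forall n \near \oo, gamma w < u n by exact: cvgr_gt u_r _ wr.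
    by apply: filterS => n wn; split => // _; exact: ltW.
  apply: nearW => n; rewrite /before /below /=; split; last by rewrite ltNge rw.
  by move=> /(le_trans rw); rewrite leNgt ur.
have : (F 0 - \int[P]_(w in before (u n)) M r%:E w) / (1 - G (u n)) @[n --> \oo] -->
    (F 0 - \int[P]_(w in below) M r%:E w) / jump_tG G.
  apply: cvgM; first by apply: cvgB => //; exact: cvg_cst.
  apply: cvgV; first by rewrite gt_eqF.
  rewrite -[X in _ --> X](subKr 1); apply: cvgB => //; exact: cvg_cst.
apply: cvg_trans; apply: near_eq_cvg.
have : \forall n \near \oo, 0 < u n by exact: cvgr_gt u_r _ r0.
apply: filterS => n un0; have jt : jump_tG G <= 1 - G (u n).
  by apply: jump_le; rewrite tGr lte_fin.
rewrite -(MG_split (ltW un0) (ur n)) addrK mulfK// gt_eqF//.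
exact: lt_le_trans jt.
Qed.

(** At an atom the value of the process is the left limit of F, and this limit is
    precisely the one that keeps the mean equal to F(0). *)
Let MG_terminal_mean : \int[P]_w M r%:E w = F 0.
Proof.
set L := (F 0 - \int[P]_(w in below) M r%:E w) / jump_tG G.
have AGr : AG G F f r = L.
  rewrite AG_above; last by rewrite tGr.
  rewrite jump_gt0 andbT tGr /left_lim /left_nbhs ifT; last first.
    by apply/asboolP; exact: cvgP F_left_lim.
  by apply/cvg_lim => //; exact: F_left_lim.
have mC : measurable (~` below) by exact: measurableC.
have -> : \int[P]_w M r%:E w =
    \int[P]_(w in below) M r%:E w + \int[P]_(w in ~` below) M r%:E w.
  rewrite -Rintegral_setU ?setvU// ?setUv//.
  by rewrite disj_set2E setICr.
have -> : \int[P]_(w in ~` below) M r%:E w = \int[P]_(w in ~` below) L.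
  rewrite /Rintegral; congr fine; apply: ae_eq_integral => //.
  - by apply: measurable_funTS; have /integrableP[] := iM.
  - apply: filterS (gamma_le_tG G0 hgamma) => w; rewrite tGr lee_fin => wr.
    move=> /negP; rewrite -leNgt => rw; have -> : M r%:E w = AG G F f (gamma w).
      by rewrite MG_after// lee_fin.
    by rewrite (_ : gamma w = r) ?AGr//; apply/le_anti; rewrite wr.
rewrite Rintegral_cst//.
have -> : fine (P (~` below)) = jump_tG G.
  have PB : P below = (1 - jump_tG G)%:E.
    rewrite -(prob_below tGr); congr (P _).
    by apply/seteqP; split => w; rewrite /below /= tGr lte_fin.
  have PC : P (~` below) = (1 - (1 - jump_tG G)%:E)%E by rewrite probability_setC// PB.
  by transitivity (fine (P (~` below))) => //; rewrite PC -EFinB/= subKr.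
by rewrite /L divfK ?gt_eqF// addrC subrK.
Qed.

Lemma MG_H1_martingale : H1_martingale_on P r%:E FF M.
Proof.
split.
  apply: (martingale_of_constant_mean mgamma (m := F 0)).
  - apply: aeW => w; apply: (@cadlag_single_jump _ _ (gamma w) (AG G F f (gamma w)) F) => //.
      move=> t t0 tr tg; apply: (density_cvg_right densf t0); rewrite tGr//.
    move=> t t0; rewrite lee_fin le_eqVlt => /predU1P[->|tr] tg.
      exact: cvgP F_left_lim.
    by apply: cvgP (density_cvg_left densf t0 _); rewrite tGr.
  - by move=> t _; exact: MG_measurable_wrt.
  - move=> t /andP[]; case: t => [t| |]//; rewrite !lee_fin => t0.
    rewrite le_eqVlt => /predU1P[->|tr]; first exact: iM.
    by have [] := @MG_integrable_mean t; rewrite ?tGr.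
  - by move=> s u w s0 su _ ws; rewrite !MG_after// (le_trans ws).
  - move=> t /andP[]; case: t => [t| |]//; rewrite !lee_fin => t0.
    rewrite le_eqVlt => /predU1P[->|tr]; first exact: MG_terminal_mean.
    by have [] := @MG_integrable_mean t; rewrite ?tGr.
have inM := integrable_norm iM.
have iB : P.-integrable setT (EFin \o (fun w => bound + `|M r%:E w|)).
  by apply: integrable_EFinD => //; exact: finite_measure_integrable_cst.
have bound0 : 0 <= bound.
  by apply: divr_ge0; [rewrite addr_ge0// Rintegral_ge0|exact: ltW].
apply: (@le_lt_trans _ _ (\int[P]_w (bound + `|M r%:E w|)%:E)%E); last first.
  have /integrableP[_] := iB; apply: le_lt_trans.
  rewrite le_eqVlt; apply/orP; left; apply/eqP; apply: eq_integral => w _.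
  by rewrite /= (ger0_norm (addr_ge0 bound0 (normr_ge0 _))).
have sup_ge0 w : (0 <= ereal_sup [set `|M t w|%:E | t in [set t | 0 <= t <= r%:E]])%E.
  apply: (@le_trans _ _ `|M 0%E w|%:E); first by rewrite lee_fin.
  by apply: ereal_sup_ubound; exists 0%E => //=; rewrite lexx lee_fin ltW.
have sup_le w : (ereal_sup [set `|M t w|%:E | t in [set t | 0 <= t <= r%:E]] <=
    (bound + `|M r%:E w|)%:E)%E.
  apply: ge_ereal_sup => _ [t /andP[t0 tr] <-]; rewrite lee_fin.
  have [wt|tw] := leP (gamma w)%:E t.
    have wr : ((gamma w)%:E <= r%:E)%E by exact: le_trans tr.
    by rewrite !MG_after// lerDr.
  case: t t0 tr tw => [t| |]//; rewrite !lee_fin lte_fin => t0.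
  rewrite le_eqVlt => /predU1P[->|tr] tw; first by rewrite lerDr.
  by rewrite (MG_before tw); apply: le_trans (F_bound t0 tr) _; rewrite lerDl.
have rhs_ge0 w : (0 <= (bound + `|M r%:E w|)%:E)%E by rewrite lee_fin addr_ge0.
(* The supremum is not known to be measurable, so its integral is compared through
   the simple functions below it. *)
rewrite (ge0_integralTE P sup_ge0) (ge0_integralTE P rhs_ge0).
apply: ereal_sup_le => _ [g gM <-]; exists g => // w.
exact: le_trans (gM w) (sup_le w).
Qed.

End integrable_terminal_value.

(** A finite variation makes f integrable on ]0, r[ and F bounded there, hence also the
    value after the jump. *)
Lemma finite_variation_integrable (r C : R) : tG G = r%:E -> 0 < r ->
  (forall (n : nat) (x : nat -> R), {homo x : i j / (i <= j)%N >-> i <= j} ->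
     (forall i, 0 <= x i < r) -> \sum_(i < n) `|F (x i.+1) - F (x i)| <= C) ->
  P.-integrable setT (EFin \o M r%:E).
Proof.
move=> tGr r0 varF; have [c [c_mono c0 ct cx]] := tG_approx.
have mI (i : interval R) : measurable ([set` i] : set (measurableTypeR R)).
  exact: measurable_itv.
have norm_f (b : R) : 0 <= b -> b < r -> \int[mu]_(v in `]0, b]) `|f v| <= C.
  move=> b0 br; have bt : (b%:E < tG G)%E by rewrite tGr.
  apply: (variation_bound b0 (density_integrable densf bt)).
    move=> s t s0 st tb; apply: (density_FB densf) => //.
    by rewrite tGr lte_fin (le_lt_trans tb).
  move=> n x x_mono xb; apply: varF => // i; have /andP[-> /le_lt_trans] := xb i.
  exact.
have cr n : c n < r by have := ct n; rewrite tGr.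
have unionE : \bigcup_n `]0, c n]%classic = `]0, r[%classic :> set (measurableTypeR R).
  apply/seteqP; split => [v [n _ /=]|v /=]; rewrite !in_itv/=.
    by move=> /andP[-> /le_lt_trans]; apply.
  move=> /andP[v0 vr]; have [|n vn] := cx v; first by rewrite tGr.
  by exists n => //=; rewrite in_itv/= v0.
have [mf _] := densf.
have mf0 : measurable_fun (`]0, r[ : set (measurableTypeR R)) f.
  by apply: measurable_funS mf => // v; rewrite /= !in_itv/= => /andP[->].
have if_r : mu.-integrable `]0, r[ (EFin \o f).
  apply/integrableP; split; first exact/measurable_EFinP.
  have cvg_int : (\int[mu]_(v in `]0%R, c n]) `|(f v)%:E| @[n --> \oo] -->
      \int[mu]_(v in `]0%R, r[) `|(f v)%:E|)%E.
    rewrite -unionE; apply: ge0_nondecreasing_set_cvg_integral => //.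
    + move=> i j ij; apply/subsetPset => v /=; rewrite !in_itv/= => /andP[-> /le_trans].
      by apply; exact: c_mono.
    + by move=> n; have /integrableP[mfn _] := density_integrable densf (ct n);
        exact: measurableT_comp.
  apply: (@le_lt_trans _ _ C%:E); last exact: ltry.
  rewrite -(cvg_lim _ cvg_int)//; apply: lime_le; first exact: cvgP cvg_int.
  apply: nearW => n; have := norm_f (c n) (c0 n) (cr n).
  rewrite -lee_fin /Rintegral fineK//.
  exact: (integrable_fin_num (mI _) (integrable_norm (density_integrable densf (ct n)))).
have if0 : P.-integrable setT (EFin \o ((f \_ `]0, r[) \o gamma)).
  apply/(law_integrable hgamma measurableT); last first.
    by rewrite -restrict_EFin; exact: ((integrable_mkcond _ (mI _)).1 if_r).
  exact/(measurable_restrictT _ (mI _)).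
pose K := `|F 0| + C + `|AG G F f r| + `|F r|.
apply: (@le_integrable _ _ _ P _ measurableT _
    (EFin \o (fun w => K + `|(f \_ `]0, r[) (gamma w)|))).
- by apply/measurable_EFinP; apply: MG_measurable; rewrite lee_fin ltW.
- move=> w _; rewrite /= lee_fin.
  have C0 : 0 <= C.
    have := varF 0%N (fun=> 0); rewrite big_ord0; apply => // i; by rewrite lexx.
  rewrite [leRHS]ger0_norm; last by rewrite !addr_ge0.
  have := normr_ge0 (F 0); have := normr_ge0 (AG G F f r); have := normr_ge0 (F r).
  have := normr_ge0 ((f \_ `]0, r[) (gamma w)).
  have [wr|rw] := ltP (gamma w) r; last first.
    have [wr'|rw'] := leP (gamma w) r.
      have -> : M r%:E w = AG G F f r.
        by rewrite MG_after ?lee_fin//; congr (AG _ _ _ _); apply/le_anti; rewrite wr'.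
      by rewrite /K; lra.
    by rewrite MG_before// /K; lra.
  have wt : ((gamma w)%:E < tG G)%E by rewrite tGr.
  have wr' : ((gamma w)%:E <= r%:E)%E by rewrite lee_fin ltW.
  rewrite (MG_after wr') patchE mem_set; last by rewrite /= in_itv/= gamma0.
  have := AG_bound G0 Gle1 densf wt (gamma0 w) (lexx _).
  have := norm_f _ (ltW (gamma0 w)) wr.
  rewrite /K; lra.
- apply: integrable_EFinD => //; first exact: finite_measure_integrable_cst.
  exact: integrable_norm if0.
Qed.

Lemma MG_not_semimartingale (r : R) : tG G = r%:E -> 0 < r ->
  ~ P.-integrable setT (EFin \o M r%:E) -> ~ semimartingale_on P r%:E M.
Proof.
move=> tGr r0 niM.
have mE : measurable (~` [set w | ((gamma w)%:E < tG G)%E]) by exact: measurableC.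
apply: (infinite_variation_not_semimartingale r0 (F := F) mE).
- have PC : P (~` [set w | ((gamma w)%:E < tG G)%E]) = (1 - (1 - jump_tG G)%:E)%E.
    by rewrite probability_setC// (prob_below tGr).
  by rewrite PC -EFinB subKr lte_fin.
- move=> w t /= /negP; rewrite -leNgt tGr lee_fin => rw /andP[t0 tr].
  by rewrite MG_before// (lt_le_trans tr).
move=> C; apply: contrapT => nvar; apply: niM.
apply: (@finite_variation_integrable r C) => // n x x_mono xr.
by rewrite leNgt; apply/negP => Cx; apply: nvar; exists n, x.
Qed.

End atom.

End single_jump_process.

(** * The theorem *)

Theorem theorem3p5 (R : realType) (d : measure_display)
    (Omega : measurableType d) (P : probability Omega R)
    (G : cumulativeBounded (0 : R) (1 : R)) (hG0 : G 0 = 0)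
    (gamma : {RV P >-> R}) (hgamma_gt0 : forall w, 0 < gamma w)
    (hgamma : forall t : R, cdf gamma t = (G t)%:E)
    (F f : R -> R) (hF : loc_abs_cont G F) (hf : is_local_density G F f) :
  let M := MG gamma G F f in
  let Fgamma := single_jump_filtration gamma in
  [/\ jump_tG G = 0 ->
        local_martingale_on P (tG G) (natural_filtration M) Fgamma M,
      0 < jump_tG G -> ~ P.-integrable setT (EFin \o M (tG G)) ->
        ~ semimartingale_on P (tG G) M &
      0 < jump_tG G -> P.-integrable setT (EFin \o M (tG G)) ->
        H1_martingale_on P (tG G) Fgamma M].
Proof.
move=> M Fgamma; have [mF _] := hF; split.
- exact: MG_local_martingale.
- move=> jump0; have [r tGr r0] := tG_real hG0 hgamma jump0.
  rewrite tGr; exact: MG_not_semimartingale.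
- move=> jump0; have [r tGr r0] := tG_real hG0 hgamma jump0.
  rewrite tGr; exact: MG_H1_martingale.
Qed.
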